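(* Let $(T_1,T_2)$ be a pair of commuting contractions on a Hilbert space $\mathcal{H}$. Then $\mathbf{T}=(T_1^m+T_2^m,\ (T_1T_2)^{m/p})$ admits a $\mathbf{\Theta}_2$-isometric dilation.
   Context: Fix integers $m,p\ge1$ with $p\mid m$. $\mathbb D$ is the open unit disc and $\mathbb T$ the unit circle in $\mathbb C$. Let $\theta:\mathbb C^2\to\mathbb C^2$, $\theta(z_1,z_2)=(z_1^m+z_2^m,(z_1z_2)^{m/p})$, and put $\mathbf{\Theta}_2=\theta(\mathbb D^2)$, $\overline{\mathbf{\Theta}}_2=\theta(\overline{\mathbb D}^{\,2})$; the distinguished (Shilov) boundary is $b\mathbf{\Theta}_2=\theta(\mathbb T^2)$. A $\mathbf{\Theta}_2$-contraction is a commuting pair of bounded operators having $\overline{\mathbf{\Theta}}_2$ as a spectral set (joint spectrum contained in $\overline{\mathbf{\Theta}}_2$ and $\|f(\mathbf T)\|\le\sup_{\overline{\mathbf{\Theta}}_2}|f|$ for all $f$ holomorphic near $\overline{\mathbf{\Theta}}_2$); the pair $\mathbf T$ in the claim is a $\mathbf{\Theta}_2$-contraction. A $\mathbf{\Theta}_2$-unitary is a commuting pair of bounded normal operators with joint spectrum in $b\mathbf{\Theta}_2$; a $\mathbf{\Theta}_2$-isometry is the restriction of a $\mathbf{\Theta}_2$-unitary to a joint invariant subspace. A $\mathbf{\Theta}_2$-isometric dilation of a $\mathbf{\Theta}_2$-contraction $(S_1,S_2)$ on $\mathcal H$ is a $\mathbf{\Theta}_2$-isometry $(W_1,W_2)$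 on a Hilbert space $\mathcal K\supseteq\mathcal H$ such that $W_i^*|_{\mathcal H}=S_i^*$ for $i=1,2$. *)

(* Defs.v *)
From HB Require Import structures.
From mathcomp Require Import all_boot all_order all_algebra.
From mathcomp Require Import sesquilinear complex.
From mathcomp Require Import all_classical all_reals all_analysis.

Set Implicit Arguments.
Unset Strict Implicit.
Unset Printing Implicit Defensive.

Import Order.TTheory GRing.Theory Num.Theory.
Import numFieldNormedType.Exports.

Local Open Scope complex_scope.
Local Open Scope classical_set_scope.
Local Open Scope ring_scope.

(* The inner product is linear in its first argument and conjugate-linear in
   its second one. As in the library, norms over R[i] take their (real,
   nonnegative) values in R[i]. *)
Record hilbertType (R : realType) := HilbertType {
  hilbert_sort :> completeNormedModType R[i];
  hdot : {dot hilbert_sort for Num.conj};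
  hdot_norm : forall x : hilbert_sort, `|x| ^+ 2 = hdot x x }.

Section Operators.
Variable R : realType.
Implicit Types H K : hilbertType R.

Definition bounded_op H (T : H -> H) : Prop :=
  linear T /\ exists M : R, forall x, `|T x| <= M%:C * `|x|.

Definition contraction_op H (T : H -> H) : Prop :=
  linear T /\ forall x, `|T x| <= `|x|.

Definition commuting_ops H (A B : H -> H) : Prop := forall x, A (B x) = B (A x).

(* [adjoint T S] means S = T^*; such an S is unique, and it is automatically
   linear and bounded when T is bounded. *)
Definition adjoint H (T S : H -> H) : Prop :=
  forall x y, hdot H (T x) y = hdot H x (S y).

Definition normal_op H (T : H -> H) : Prop :=
  bounded_op T /\ exists2 S, adjoint T S & commuting_ops T S.

Definition isometric_embedding H K (V : H -> K) : Prop :=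
  linear V /\ forall x y, hdot K (V x) (V y) = hdot H x y.

(* Exactness of the Koszul complex 0 -> H -> H (+) H -> H -> 0 of a commuting
   pair (A, B), with maps z |-> (A z, B z) and (x, y) |-> A y - B x. *)
Definition koszul_exact H (A B : H -> H) : Prop :=
  [/\ forall z, A z = 0 -> B z = 0 -> z = 0,
      forall x y, A y = B x -> exists z, A z = x /\ B z = y &
      forall w, exists x y, A y - B x = w].

(* Taylor's joint spectrum of a commuting pair. *)
Definition joint_spectrum H (S1 S2 : H -> H) : set (R[i] * R[i]) :=
  [set l | ~ koszul_exact (fun x => S1 x - l.1 *: x)
                          (fun x => S2 x - l.2 *: x)].

End Operators.

Section Theta.
Variable R : realType.
Variables m p : nat.

Definition theta (z : R[i] * R[i]) : R[i] * R[i] :=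
  (z.1 ^+ m + z.2 ^+ m, (z.1 * z.2) ^+ (m %/ p)).

Definition bTheta : set (R[i] * R[i]) :=
  theta @` [set z | `|z.1| = 1 /\ `|z.2| = 1].

Definition theta_unitary (L : hilbertType R) (U1 U2 : L -> L) : Prop :=
  [/\ normal_op U1, normal_op U2, commuting_ops U1 U2 &
      joint_spectrum U1 U2 `<=` bTheta].

(* The restriction of (U1, U2) to a closed joint invariant subspace is given
   through an isometric embedding J of K onto that subspace. *)
Definition theta_isometry (K : hilbertType R) (W1 W2 : K -> K) : Prop :=
  exists (L : hilbertType R) (U1 U2 : L -> L) (J : K -> L),
    [/\ theta_unitary U1 U2, isometric_embedding J,
        forall x, U1 (J x) = J (W1 x) & forall x, U2 (J x) = J (W2 x)].

(* K contains H through the isometric embedding V; the last two conditions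
   say that W_i^* restricted to H is S_i^*. *)
Definition theta_isometric_dilation (H : hilbertType R) (S1 S2 : H -> H)
    (K : hilbertType R) (V : H -> K) (W1 W2 : K -> K) : Prop :=
  [/\ isometric_embedding V,
      theta_isometry W1 W2,
      exists A1 B1, [/\ adjoint W1 A1, adjoint S1 B1 &
                        forall h, A1 (V h) = V (B1 h)] &
      exists A2 B2, [/\ adjoint W2 A2, adjoint S2 B2 &
                        forall h, A2 (V h) = V (B2 h)]].

End Theta.

(* Main.v *)
(* The isometric lifting is obtained from Ando's theorem: the commuting
   contractions T1, T2 lift to commuting isometries V1, V2 with V_i^* extending
   T_i^*, and W = (V1^m + V2^m, (V1 V2)^(m/p)). Applying Ando's theorem once more,
   to V1^*, V2^*, and cutting down to the subspace on which the product of the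
   resulting isometries is unitary, extends V1, V2 to commuting unitaries U1, U2,
   so that W is the restriction of N = theta (U1, U2).

   The joint spectrum of N is located without a spectral theorem. Given l, let
   a, b be the roots of X^2 - l_1 X + l_2^p. If |a| = |b| = 1 then l is in
   theta (T^2). Otherwise, say |a| <> 1; then U_i^m - a is invertible, and a
   product of such factors lies in the ideal generated by N_1 - l_1 and N_2 - l_2,
   which makes the Koszul complex exact. *)
Require Import Defs.
From HB Require Import structures.
From mathcomp Require Import all_boot all_order all_algebra.
From mathcomp Require Import sesquilinear complex ring lra.
From mathcomp Require Import all_classical all_reals all_analysis.

Set Implicit Arguments.
Unset Strict Implicit.
Unset Printing Implicit Defensive.

Import Order.TTheory GRing.Theory Num.Theory.
Import numFieldNormedType.Exports.

Local Open Scope complex_scope.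
Local Open Scope classical_set_scope.
Local Open Scope ring_scope.

Local Notation Re := complex.Re.
Local Notation Im := complex.Im.
Local Notation "''[' u , v ]" := (hdot _ u v).

(** * Hilbert spaces and the Riesz lemma *)

(** The only Hilbert space built is that of square-summable sequences, so direct sums have to be
    found inside it. On [l2_hilbert H] the even and odd entries give two isometries with
    complementary ranges; this supplies the room that Ando's construction needs for a pair of defect
    vectors and for a unitary completion, while [H] itself enters as coordinate 0.

    A single least-squares lemma, [riesz], is stated along an arbitrary map [L] whose range need not
    be closed. It yields adjoints ([L] the identity), orthogonal projections (an inclusion), the
    partial isometry behind Ando's unitary, and the inverse of [Q - a] (with [L] the adjoint
    operator).

    The roots a, b come from N_1 = U1^m + U2^m and N_2^p = U1^m U2^m: at a point l = theta (z) they
    are z_1^m and z_2^m. *)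

Lemma dot_Cauchy_Schwarz (R : realType) (V : lmodType R[i])
    (f : {dot V for Num.conj}) (x y : V) :
  Re (f x y) ^+ 2 + Im (f x y) ^+ 2 <= Re (f x x) * Re (f y y).
Proof.
have ge0 u : (f u u = (Re (f u u))%:C) /\ 0 <= Re (f u u).
  have [->|u0] := eqVneq u 0; first by rewrite linear0l /= lexx.
  have : 0 < f u u by exact: neq0_dnorm_gt0.
  rewrite ltcE.
  by case: (f u u) => a b /= /andP[/eqP -> /ltW ->].
have [x2 x0] := ge0 x; have [y2] := ge0 y; rewrite le0r => /orP[/eqP|yp].
  move=> y0; have [->|yn0] := eqVneq y 0.
    by rewrite !linear0r /= !expr0n /= addr0.
  have : 0 < f y y by exact: neq0_dnorm_gt0.
  by rewrite y2 y0 ltxx.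
(* The vector is [f y y] times the component of [x] orthogonal to [y]; its squared length is [f y y]
   times the gap in the inequality. *)
have [_] := ge0 (f y y *: x - f x y *: y).
rewrite linearBl !linearBr !linearZl_LR !linearZr_LR /= y2 x2.
rewrite (hermC f y x) expr0 mul1r /=.
move: yp; move: (Re (f x x)) (Re (f y y)) => p q q0.
case: (f x y) => a b /=.
rewrite [leRHS](_ : _ = q * (p * q - (a ^+ 2 + b ^+ 2))); last by ring.
by rewrite pmulr_rge0 // subr_ge0.
Qed.

Section InnerProduct.
Variables (R : realType) (H : hilbertType R).
Implicit Types (x y z : H) (a : R[i]).

Lemma ipDl x y z : '[x + y, z] = '[x, z] + '[y, z].
Proof. exact: linearDl. Qed.

Lemma ipZl a x z : '[a *: x, z] = a * '[x, z].
Proof. exact: linearZl_LR. Qed.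

Lemma ipC x y : '[x, y] = ('[y, x])^*%C.
Proof. by rewrite (hermC (hdot H)) expr0 mul1r. Qed.

Lemma ipNl x z : '[- x, z] = - '[x, z].
Proof. exact: linearNl. Qed.

Lemma ipBl x y z : '[x - y, z] = '[x, z] - '[y, z].
Proof. exact: linearBl. Qed.

Lemma ip0l z : '[0, z] = 0 :> R[i].
Proof. exact: linear0l. Qed.

Lemma ipDr x y z : '[z, x + y] = '[z, x] + '[z, y].
Proof. exact: linearDr. Qed.

Lemma ipZr a x z : '[z, a *: x] = a^*%C * '[z, x].
Proof. exact: linearZr_LR. Qed.

Lemma ipNr x z : '[z, - x] = - '[z, x].
Proof. exact: linearNr. Qed.

Lemma ipBr x y z : '[z, x - y] = '[z, x] - '[z, y].
Proof. exact: linearBr. Qed.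

Lemma ip0r z : '[z, 0] = 0 :> R[i].
Proof. exact: linear0r. Qed.

Definition ipE := (ipDl, ipDr, ipBl, ipBr, ipNl, ipNr, ipZl, ipZr, ip0l, ip0r).

Lemma ip_ge0 x : 0 <= '[x, x].
Proof. by rewrite -hdot_norm exprn_ge0. Qed.

(** Real-valued, unlike the norm with values in [R[i]], so that [lra] and [nra] apply to squared
    lengths. *)
Definition nsq x : R := Re '[x, x].

Lemma nsqE x : '[x, x] = (nsq x)%:C.
Proof.
rewrite /nsq; move: (ip_ge0 x); case: '[x, x] => a b.
by rewrite lecE /= => /andP[/eqP -> _].
Qed.

Lemma nsq_ge0 x : 0 <= nsq x.
Proof. by have := ip_ge0 x; rewrite nsqE ler0c. Qed.

Lemma normE x : `|x| = (Num.sqrt (nsq x))%:C.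
Proof.
apply/eqP; rewrite -(@eqrXn2 _ 2) ?normr_ge0 ?ler0c ?sqrtr_ge0 //.
by rewrite -rmorphXn /= sqr_sqrtr ?nsq_ge0 // hdot_norm nsqE.
Qed.

Lemma nsq0_eq0 x : nsq x = 0 -> x = 0.
Proof.
by move=> h; apply/eqP; rewrite -normr_eq0 normE h sqrtr0.
Qed.

Lemma nsq0 : nsq (0 : H) = 0.
Proof. by rewrite /nsq ip0l. Qed.

Lemma nsqZ a x : nsq (a *: x) = (Re a ^+ 2 + Im a ^+ 2) * nsq x.
Proof.
rewrite {1}/nsq ipZl ipZr nsqE; case: a => a b /=; ring.
Qed.

Lemma nsqD x y : nsq (x + y) = nsq x + nsq y + Re '[x, y] *+ 2.
Proof.
rewrite {1}/nsq !ipE (ipC y x) !nsqE; case: '[x, y] => a b /=; ring.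
Qed.

Lemma nsqN x : nsq (- x) = nsq x.
Proof. by rewrite /nsq !ipE opprK. Qed.

Lemma nsqB x y : nsq (x - y) = nsq x + nsq y - Re '[x, y] *+ 2.
Proof. by rewrite nsqD nsqN ipNr /= raddfN /= mulNrn. Qed.

Lemma nsqDle x y : nsq (x + y) <= (nsq x + nsq y) *+ 2.
Proof.
have := nsq_ge0 (x - y); rewrite nsqB nsqD; lra.
Qed.

Lemma nsqBle x y : nsq (x - y) <= (nsq x + nsq y) *+ 2.
Proof. by rewrite -(nsqN y) nsqDle. Qed.

Lemma ip_inj x y : (forall z, '[x, z] = '[y, z]) -> x = y.
Proof.
move=> h; apply/eqP; rewrite -subr_eq0; apply/eqP/nsq0_eq0.
by rewrite /nsq ipBl h subrr.
Qed.

Lemma ip_inj2 x y : (forall z, '[z, x] = '[z, y]) -> x = y.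
Proof. by move=> h; apply: ip_inj => z; rewrite ipC h -ipC. Qed.

Lemma Cauchy_Schwarz x y : Re '[x, y] ^+ 2 + Im '[x, y] ^+ 2 <= nsq x * nsq y.
Proof. exact: dot_Cauchy_Schwarz. Qed.

Lemma cvg_nsq (u : nat -> H) :
  (forall e : R, 0 < e -> exists N, forall n m, (N <= n)%N -> (N <= m)%N ->
    nsq (u n - u m) <= e) ->
  exists l, forall e : R, 0 < e -> exists N, forall n, (N <= n)%N ->
    nsq (u n - l) <= e.
Proof.
move=> hu.
have: cauchy (u @ \oo).
  apply/cauchy_exP => e e0.
  have e0' : 0 < Re e /\ e = (Re e)%:C.
    by move: e0; case: e => a b; rewrite ltcE /= => /andP[/eqP -> ->].
  have e2 : 0 < (Re e / 2) ^+ 2 by rewrite exprn_gt0 // divr_gt0 //; case: e0'.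
  have [N hN] := hu _ e2.
  exists (u N).
  exists N => // n /= Nn.
  rewrite -ball_normE /= normE e0'.2 ltcR.
  have := hN _ _ (leqnn N) Nn.
  rewrite -ler_sqrt; last by rewrite exprn_ge0 // divr_ge0 //; case: e0'; lra.
  rewrite sqrtr_sqr ger0_norm; last by case: e0'; lra.
  move=> /le_lt_trans; apply; case: e0'; lra.
move=> /cauchy_cvg /cvg_ex[l hl]; exists l => e e0.
have se : 0 < (Num.sqrt e)%:C :> R[i] by rewrite ltcR sqrtr_gt0.
have := (@cvgrPdist_le _ _ _ _ _ _ l).1 hl _ se.
case=> N _ hN; exists N => n Nn.
have := hN n Nn; rewrite normE lecR ler_sqrt; last by lra.
by rewrite -nsqN opprB.
Qed.

End InnerProduct.

Section Riesz.
Variables (R : realType).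

Lemma complex0_eps (a : R[i]) :
  (forall e : R, 0 < e -> Re a ^+ 2 + Im a ^+ 2 <= e) -> a = 0.
Proof.
move=> h.
have /eqP : Re a ^+ 2 + Im a ^+ 2 = 0.
  apply/eqP; rewrite eq_le addr_ge0 ?sqr_ge0 // andbT.
  by apply/ler_addgt0Pr => e e0; rewrite add0r h.
rewrite paddr_eq0 ?sqr_ge0 // !sqrf_eq0; case: a {h} => a b /=.
by move=> /andP[/eqP -> /eqP ->].
Qed.

(* Minimising |L x|^2 - 2 Re (phi x): the parallelogram identity makes
   minimising sequences Cauchy, and their limit represents phi. *)
Lemma riesz (Y : hilbertType R) (X : Type) (x0 : X) (L : X -> Y)
    (phi : X -> R[i]) (C : R) :
  0 <= C ->
  (forall a x y, exists t, L t = a *: L x + L y /\ phi t = a * phi x + phi y) ->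
  (forall x, Re (phi x) ^+ 2 + Im (phi x) ^+ 2 <= C * nsq (L x)) ->
  exists z, [/\ forall x, phi x = '[L x, z],
    forall u, (forall x, '[L x, u] = 0) -> '[z, u] = 0 & nsq z <= C].
Proof.
move=> C0 lin bnd.
pose J x := nsq (L x) - Re (phi x) *+ 2.
(* With [n = nsq (L x)] and [r = Re (phi x)], [r^2 <= n C] gives [2 r <= n + C] by the inequality of
   means. *)
have JC x : - C <= J x.
  rewrite /J; have := bnd x; have := nsq_ge0 (L x).
  have := sqr_ge0 (Im (phi x)).
  move: (nsq (L x)) (Re (phi x)) (Im (phi x)) => n r i i0 n0 rn.
  suff: r *+ 2 <= n + C by lra.
  have [r0|r0] := leP r 0; first by lra.
  have sq : (r *+ 2) ^+ 2 <= (n + C) ^+ 2.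
    have := sqr_ge0 (n - C); nra.
  by move: sq; rewrite ler_sqr // nnegrE; lra.
pose d := inf (range J).
have hlb : has_lbound (range J) by exists (- C) => _ [x _ <-].
have dJ x : d <= J x by apply: ge_inf => //; exists x.
have /choice[u hu] (n : nat) : exists x, J x <= d + n.+1%:R^-1.
  have hi : has_inf (range J) by split => //; exists (J x0), x0.
  have e0 : (0 : R) < n.+1%:R^-1 by rewrite invr_gt0 ltr0n.
  by have [_ [x _ <-] hx] := inf_adherent e0 hi; exists x; exact: ltW.
have small (e : R) : 0 < e -> exists N, forall n, (N <= n)%N -> n.+1%:R^-1 <= e.
  move=> e0; exists (Num.truncn e^-1).+1 => n Nn.
  rewrite -[leRHS]invrK lef_pV2 ?posrE ?invr_gt0 ?ltr0n //.
  apply: ltW; apply: (lt_le_trans (truncnS_gt _)).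
  by rewrite ler_nat; apply: leq_trans Nn _.
(* The midpoint [c] is obtained as [- s / 2 + s] because [lin] only provides combinations [a x + y].
   By the parallelogram identity, [J x + J y - 2 J c] is half of [nsq (L x - L y)]. *)
have par x y e : J x <= d + e -> J y <= d + e -> nsq (L x - L y) <= e *+ 4.
  move=> hx hy; have [s [sL sphi]] := lin 1 x y.
  have [c [cL cphi]] := lin (- (2^-1)) s s.
  have := dJ c; move: hx hy; rewrite /J cL cphi.
  have -> : - 2^-1 *: L s + L s = (2^-1 : R)%:C *: L s.
    rewrite -[in X in _ + X](scale1r (L s)) -scalerDl; congr (_ *: _).
    by rewrite fmorphV /= rmorph_nat; field.
  have -> : - 2^-1 * phi s + phi s = (2^-1 : R)%:C * phi s.
    by rewrite fmorphV /= rmorph_nat; field.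
  rewrite nsqZ /= sL sphi scale1r mul1r expr0n /= addr0.
  rewrite nsqB nsqD.
  case: (phi x) => a b; case: (phi y) => a' b' /=; rewrite mul0r subr0.
  move: (nsq (L x)) (nsq (L y)) (Re '[L x, L y]) => p q r; lra.
have [z hz] : exists l, forall e : R, 0 < e -> exists N, forall n, (N <= n)%N ->
    nsq (L (u n) - l) <= e.
  apply: cvg_nsq => e e0.
  have [|N hN] := small (e / 4); first by lra.
  exists N => n m Nn Nm; have -> : e = (e / 4) *+ 4 by lra.
  apply: par.
    by apply: le_trans (hu n) _; rewrite lerD2l hN.
  by apply: le_trans (hu m) _; rewrite lerD2l hN.
have hphi x : phi x = '[L x, z].
  apply/eqP; rewrite eq_sym -subr_eq0; apply/eqP; apply: complex0_eps => e e0.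
  (* First variation: [J] is nearly minimal at [u n], hence drops by at most [e'] on moving to
     [u n - t (conj w) x]. The choices [t = 1 / (N + 1)] and [e' = e t^2 / 2] turn this into
     [|w|^2 <= e]. *)
  set w := '[L x, z] - phi x.
  pose N := nsq (L x); have N0 : 0 <= N by exact: nsq_ge0.
  pose e' := e / (N + 1) ^+ 2 / 2.
  have N1 : 0 < (N + 1) ^+ 2 by rewrite exprn_gt0 //; lra.
  have e'0 : 0 < e' by rewrite !divr_gt0.
  have [n1 hn1] := small _ e'0; have [n2 hn2] := hz _ e'0.
  pose n := maxn n1 n2; have [k1 k2] := (leq_maxl n1 n2, leq_maxr n1 n2).
  have {}hn1 := le_trans (hu n) (lerD (lexx d) (hn1 n k1)).
  have {}hn2 := hn2 n k2.
  pose t := (N + 1)^-1.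
  have t0 : 0 < t by rewrite invr_gt0; lra.
  have [c [cL cphi]] := lin (- t%:C * w^*%C) x (u n).
  have := dJ c; move: hn1; rewrite /J cL cphi nsqD nsqZ ipZl.
  have CS := Cauchy_Schwarz (L x) (L (u n) - z); move: CS.
  rewrite -/N.
  have -> : '[L x, L (u n)] = '[L x, L (u n) - z] + w + phi x.
    rewrite /w ipBr; ring.
  move: hn2; move: (nsq (L (u n) - z)) => v hv.
  move: (w) '[L x, L (u n) - z] (phi x) (phi (u n)) (nsq (L (u n))).
  move=> [w1 w2] [v1 v2] [p1 p2] [q1 q2] m /= CS h1 h2.
  have {}CS : v1 ^+ 2 + v2 ^+ 2 <= N * e'.
    by apply: le_trans CS _; rewrite ler_wpM2l.
  have tN : t * N = 1 - t by rewrite /t; field; lra.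
  have ee : e' *+ 2 = e * t ^+ 2 by rewrite /e' /t; field; lra.
  pose W := w1 ^+ 2 + w2 ^+ 2.
  have key : t * W *+ 2 <= t ^+ 2 * W * N + e' - (t * (w1 * v1 + w2 * v2)) *+ 2.
    move: h1 h2; rewrite /W; nra.
  have key2 : t * W <= t ^+ 2 * W * N + e' + t * (v1 ^+ 2 + v2 ^+ 2).
    have := ler_wpM2l (ltW t0) (addr_ge0 (sqr_ge0 (w1 + v1)) (sqr_ge0 (w2 + v2))).
    rewrite mulr0; move: key; rewrite /W; nra.
  have key3 : t ^+ 2 * W <= e' + t * (N * e').
    have : t * (v1 ^+ 2 + v2 ^+ 2) <= t * (N * e') by rewrite ler_wpM2l // ltW.
    move: key2; have -> : t ^+ 2 * W * N = t * W * (t * N) by ring.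
    rewrite tN; lra.
  have key4 : t ^+ 2 * W <= t ^+ 2 * e.
    apply: le_trans key3 _; rewrite mulrA tN [t ^+ 2 * e]mulrC -ee.
    nra.
  by rewrite ler_pM2l in key4; rewrite // exprn_gt0.
exists z; split => // [v hv|]; last first.
  (* By [hphi], [J (u n) = nsq (L (u n) - z) - nsq z], which is at least [- C]. *)
  apply/ler_addgt0Pr => e /hz[n hn]; have := JC (u n); have := hn n (leqnn n).
  by rewrite /J hphi nsqB; lra.
(* [z] is the limit of the [L (u n)], all orthogonal to [v]. *)
apply: complex0_eps => e e0.
have e'0 : 0 < e / (nsq v + 1) by rewrite divr_gt0 // ltr_wpDl ?nsq_ge0.
have [n hn] := hz _ e'0.
have -> : '[z, v] = - '[L (u n) - z, v] by rewrite ipBl hv; ring.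
rewrite !raddfN /= !sqrrN; apply: le_trans (Cauchy_Schwarz _ _) _.
have := hn n (leqnn n); rewrite ler_pdivlMr ?ltr_wpDl ?nsq_ge0 //.
have := nsq_ge0 (L (u n) - z); nra.
Qed.

End Riesz.

(** * Adjoints and defect operators *)

Section Operators.
Variable R : realType.
Implicit Types H K L : hilbertType R.

Lemma linE H K (T : H -> K) : linear T ->
  (forall x y, T (x - y) = T x - T y) * (forall x y, T (x + y) = T x + T y) *
  (forall x, T (- x) = - T x) * (forall a x, T (a *: x) = a *: T x) * (T 0 = 0).
Proof.
move=> lT; have lD x y : T (x + y) = T x + T y.
  by rewrite -[x in LHS]scale1r lT scale1r.
have l0 : T 0 = 0 by apply: (@addIr _ (T 0)); rewrite -lD !add0r.
have lZ a x : T (a *: x) = a *: T x by rewrite -[a *: x in LHS]addr0 lT l0 addr0.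
have lN x : T (- x) = - T x by rewrite -scaleN1r lZ scaleN1r.
by do !split => //; move=> x y; rewrite lD lN.
Qed.

Definition adj H K (T : H -> K) (S : K -> H) : Prop :=
  forall x y, '[T x, y] = '[x, S y].

Lemma adj_sym H K (T : H -> K) S : adj T S -> adj S T.
Proof. by move=> h x y; rewrite ipC -h -ipC. Qed.

Lemma adj_linear H K (T : H -> K) S : adj T S -> linear T.
Proof. by move=> h a x y; apply: ip_inj => z; rewrite !(ipE, h). Qed.

Lemma adj_comp H K L (T : H -> K) S (T' : K -> L) S' :
  adj T S -> adj T' S' -> adj (T' \o T) (S \o S').
Proof. by move=> h h' x y; rewrite /= h' h. Qed.

Lemma adj_iter H (T S : H -> H) n : adj T S -> adj (iter n T) (iter n S).
Proof.
move=> h; elim: n => [|n IH] x y //=.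
by rewrite h IH -iterSr.
Qed.

Lemma adjD H K (T T' : H -> K) S S' : adj T S -> adj T' S' ->
  adj (fun x => T x + T' x) (fun x => S x + S' x).
Proof. by move=> h h' x y; rewrite !ipE h h'. Qed.

Lemma adj_exists H K (T : H -> K) (C : R) : 0 <= C -> linear T ->
  (forall x, nsq (T x) <= C * nsq x) -> exists S, adj T S.
Proof.
move=> C0 lT bT.
have /choice[S hS] : forall y, exists z, forall x, '[T x, y] = '[x, z].
  move=> y.
  have [|a x x'|x|z [hz _ _]] :=
      @riesz R H H 0 id (fun x => '[T x, y]) (C * nsq y).
  - by rewrite mulr_ge0 ?nsq_ge0.
  - by exists (a *: x + x'); rewrite lT ipDl ipZl.
  - apply: le_trans (Cauchy_Schwarz _ _) _.
    by rewrite mulrAC ler_wpM2r ?nsq_ge0.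
  - by exists z.
by exists S.
Qed.

Definition contractive H K (T : H -> K) : Prop := forall x, nsq (T x) <= nsq x.

(** Cauchy-Schwarz for [T (S y)] and [y] gives [|S y|^4 <= |T S y|^2 |y|^2 <= |S y|^2 |y|^2]. *)
Lemma contractive_adj H K (T : H -> K) S :
  adj T S -> contractive T -> contractive S.
Proof.
move=> h cT y.
have := Cauchy_Schwarz (T (S y)) y; rewrite h nsqE /= expr0n addr0 => hh.
have [->|] := eqVneq (nsq (S y)) 0; first exact: nsq_ge0.
move=> s0; have sp : 0 < nsq (S y) by rewrite lt0r s0 nsq_ge0.
rewrite -(ler_pM2l sp) -expr2; apply: le_trans hh _.
by rewrite ler_wpM2r ?nsq_ge0.
Qed.

(** The adjoint is carried as data: [adj_linear] then provides linearity, and such pairs are stable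
    under composition and under exchanging the two operators. *)
Definition cpair H K (T : H -> K) (S : K -> H) : Prop := adj T S /\ contractive T.

Lemma cpair_sym H K (T : H -> K) S : cpair T S -> cpair S T.
Proof. by case=> h c; split; [exact: adj_sym|exact: contractive_adj h c]. Qed.

Lemma cpair_comp H K L (T : H -> K) S (T' : K -> L) S' :
  cpair T S -> cpair T' S' -> cpair (T' \o T) (S \o S').
Proof.
move=> [h c] [h' c']; split; first exact: adj_comp.
by move=> x; apply: le_trans (c' _) (c _).
Qed.

Lemma contraction_cpair H (T : H -> H) : contraction_op T -> exists S, cpair T S.
Proof.
move=> [lT cT].
have c : contractive T.
  move=> x; have := cT x.
  by rewrite !normE lecR ler_sqrt ?nsq_ge0.
have [x|S hS] := @adj_exists _ _ T 1 ler01 lT; last by exists S.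
by rewrite mul1r.
Qed.

Lemma isometry_contractive H K (T : H -> K) S :
  adj T S -> (forall x, S (T x) = x) -> contractive T.
Proof. by move=> h i x; rewrite /nsq h i. Qed.

Lemma le_norm_nsq H (c : R) (x y : H) : 0 <= c ->
  (`|y| <= c%:C * `|x|) = (nsq y <= c ^+ 2 * nsq x).
Proof.
move=> c0; rewrite !normE -rmorphM /= lecR.
have -> : c * Num.sqrt (nsq x) = Num.sqrt (c ^+ 2 * nsq x).
  by rewrite sqrtrM ?sqr_ge0 // sqrtr_sqr ger0_norm.
by rewrite ler_sqrt // mulr_ge0 ?sqr_ge0 ?nsq_ge0.
Qed.

Definition hcvg H (u : nat -> H) (l : H) : Prop :=
  forall e : R, 0 < e -> exists N, forall n, (N <= n)%N -> nsq (u n - l) <= e.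

Lemma hcvg_ip_eq H K (u : nat -> H) (v : nat -> K) l l' y x :
  hcvg u l -> hcvg v l' -> (forall n, '[u n, y] = '[x, v n]) -> '[l, y] = '[x, l'].
Proof.
move=> hu hv h; apply/eqP; rewrite -subr_eq0; apply/eqP/complex0_eps => e e0.
pose c := nsq x + nsq y + 1.
have c0 : 0 < c by rewrite ltr_wpDl ?addr_ge0 ?nsq_ge0.
have e'0 : 0 < e / c / 4 by rewrite !divr_gt0.
have [n1 h1] := hu _ e'0; have [n2 h2] := hv _ e'0.
pose n := maxn n1 n2.
have {}h1 := h1 n (leq_maxl n1 n2); have {}h2 := h2 n (leq_maxr n1 n2).
have -> : '[l, y] - '[x, l'] = '[x, v n - l'] - '[u n - l, y].
  by rewrite !ipE h; ring.
have := Cauchy_Schwarz x (v n - l'); have := Cauchy_Schwarz (u n - l) y.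
move: h1 h2; set a := nsq (u n - l); set b := nsq (v n - l').
case: '[u n - l, y] => p q; case: '[x, v n - l'] => p' q' /= h1 h2 h3 h4.
have h5 : nsq x * b <= nsq x * (e / c / 4) by rewrite ler_wpM2l ?nsq_ge0.
have h6 : a * nsq y <= (e / c / 4) * nsq y by rewrite ler_wpM2r ?nsq_ge0.
have h7 : e = (e / c / 4) * c * 4 by field; rewrite gt_eqF.
rewrite h7 /c; move: (e / c / 4) h5 h6 e'0 => d h5 h6 d0.
have : 0 <= (p + p') ^+ 2 + (q + q') ^+ 2 by rewrite addr_ge0 ?sqr_ge0.
have := nsq_ge0 x; have := nsq_ge0 y; nra.
Qed.

Lemma hcvg_unique H (u : nat -> H) l l' : hcvg u l -> hcvg u l' -> l = l'.
Proof.
move=> h h'; apply/eqP; rewrite -subr_eq0; apply/eqP/nsq0_eq0/eqP.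
rewrite eq_le nsq_ge0 andbT; apply/ler_addgt0Pr => e e0; rewrite add0r.
have e4 : 0 < e / 4 by rewrite divr_gt0.
have [n1 h1] := h _ e4; have [n2 h2] := h' _ e4.
have {}h1 := h1 _ (leq_maxl n1 n2); have {}h2 := h2 _ (leq_maxr n1 n2).
set n := maxn n1 n2 in h1 h2.
have -> : l - l' = (u n - l') - (u n - l) by rewrite opprB [RHS]addrC addrA subrK.
by apply: le_trans (nsqBle _ _) _; lra.
Qed.

Lemma norm_le_nsq H (y : H) (r : R) : 0 <= r -> `|y| <= r%:C -> nsq y <= r ^+ 2.
Proof.
move=> r0; rewrite normE lecR => h.
by rewrite -(sqr_sqrtr (nsq_ge0 y)) ler_sqr // nnegrE sqrtr_ge0.
Qed.

(** The differences telescope against those of a bounded monotone real sequence, which is Cauchy. *)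
Lemma hcvg_domin H (u : nat -> H) (c : nat -> R) (b : R) :
  (forall n, c n <= c n.+1) -> (forall n, c n <= b) ->
  (forall n, `|u n.+1 - u n| <= (c n.+1 - c n)%:C) -> exists l, hcvg u l.
Proof.
move=> cm cb hu; apply: cvg_nsq => e e0.
have dist n k : `|u (n + k)%N - u n| <= (c (n + k)%N - c n)%:C.
  elim: k => [|k IH]; first by rewrite addn0 !subrr normr0.
  have -> : u (n + k.+1)%N - u n = (u (n + k).+1 - u (n + k)%N) + (u (n + k)%N - u n).
    by rewrite addnS addrA subrK.
  apply: le_trans (ler_normD _ _) _; apply: le_trans (lerD (hu _) IH) _.
  by rewrite -rmorphD /= addnS lecR; lra.
have cm' : {homo c : n m / (n <= m)%N >-> n <= m} by apply/nondecreasing_seqP.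
have cl : cvgn c.
  by apply: nondecreasing_is_cvgn => //; exists b => _ [n _ <-].
have s0 : 0 < Num.sqrt e / 2 by rewrite divr_gt0 ?sqrtr_gt0.
have [N _ hN] := (@cvgrPdist_le _ _ _ _ _ _ _).1 cl _ s0.
have le_l := nondecreasing_cvgn_le cm' cl.
have near_N n : (N <= n)%N -> `|u n - u N| <= (Num.sqrt e / 2)%:C.
  move=> Nn; rewrite -(subnKC Nn); apply: le_trans (dist _ _) _; rewrite lecR.
  have := hN N (leqnn N); have := le_l (N + (n - N))%N; have := le_l N => /= h1 h2.
  by rewrite ger0_norm; lra.
exists N => n m Nn Nm; rewrite -[leRHS](sqr_sqrtr (ltW e0)).
apply: norm_le_nsq; first exact: sqrtr_ge0.
have -> : u n - u m = (u n - u N) - (u m - u N) by rewrite opprB addrA subrK.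
apply: le_trans (ler_normB _ _) _.
apply: le_trans (lerD (near_N _ Nn) (near_N _ Nm)) _.
by rewrite -rmorphD /= lecR; lra.
Qed.

End Operators.

(* The square root of 1 - B, for a positive contraction B = T^* T, is 1 - Y
   where Y is the limit of the iteration Y_(n+1) = (B + Y_n^2) / 2; the scalar
   iteration q_n, with B replaced by 1, controls the increments. *)
Section Defect.
Variables (R : realType) (H : hilbertType R) (T S : H -> H).
Hypothesis TS : cpair T S.

Let B x := S (T x).

Let adjB : adj B B.
Proof. by move=> x y; rewrite /B (adj_sym TS.1) TS.1. Qed.

Let lB := linE (adj_linear adjB).

Fixpoint defect_iter n (x : H) : H :=
  if n is n.+1 then (2^-1 : R[i]) *: (B x + defect_iter n (defect_iter n x)) else 0.

Local Notation Y := defect_iter.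

Fixpoint defect_bound n : R :=
  if n is n.+1 then (1 + defect_bound n ^+ 2) / 2 else 0.

Local Notation q := defect_bound.

Let half_conj : ((2^-1 : R[i])^* = 2^-1)%C.
Proof. by rewrite conjc_inv conjc_nat. Qed.

Let YS n x : Y n.+1 x = (2^-1 : R[i]) *: (B x + Y n (Y n x)).
Proof. by []. Qed.

Let adjY n : adj (Y n) (Y n).
Proof.
elim: n => [|n IH] x y /=; first by rewrite !ipE.
by rewrite !ipE adjB !IH half_conj.
Qed.

Let lY n := linE (adj_linear (@adjY n)).

Let YB n x : Y n (B x) = B (Y n x).
Proof.
elim: n x => [|n IH] x /=; first by rewrite lB.
by rewrite !lB !IH.
Qed.

Let YY n m x : Y n (Y m x) = Y m (Y n x).
Proof.
elim: m x => [|m IH] x /=; first by rewrite lY.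
by rewrite !lY YB !IH.
Qed.

Let q_ge0 n : 0 <= q n.
Proof. by case: n => //= n; rewrite divr_ge0 ?addr_ge0 ?sqr_ge0. Qed.

Let q_le1 n : q n <= 1.
Proof. by elim: n => //= n IH; have := q_ge0 n; nra. Qed.

Let q_incr n : q n <= q n.+1.
Proof. by rewrite /=; have := sqr_ge0 (1 - q n); lra. Qed.

Let normB x : `|B x| <= `|x|.
Proof.
rewrite !normE lecR ler_sqrt ?nsq_ge0 //.
by apply: le_trans ((cpair_sym TS).2 _) (TS.2 _).
Qed.

Let half_norm (x : H) : `|(2^-1 : R[i]) *: x| = (2^-1 : R)%:C * `|x|.
Proof. by rewrite normrZ fmorphV /= rmorph_nat ger0_norm // invr_ge0. Qed.

Let normY n x : `|Y n x| <= (q n)%:C * `|x|.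
Proof.
elim: n x => [|n IH] x /=; first by rewrite normr0 mul0r.
have -> : ((1 + q n ^+ 2) / 2)%:C = (2^-1)%:C * (1 + (q n)%:C * (q n)%:C).
  by rewrite -(rmorph1 (real_complex R)) -!(rmorphM, rmorphD) /= mulrC expr2.
rewrite half_norm -mulrA ler_wpM2l ?ler0c ?invr_ge0 // mulrDl mul1r.
apply: le_trans (ler_normD _ _) (lerD (normB x) _).
apply: le_trans (IH _) _.
by rewrite -mulrA ler_wpM2l ?ler0c.
Qed.

Let normYS n x : `|Y n.+1 x - Y n x| <= (q n.+1 - q n)%:C * `|x|.
Proof.
elim: n x => [|n IH] x.
  rewrite /= subr0 addr0 expr0n /= addr0 subr0 half_norm mul1r.
  by rewrite ler_wpM2l ?ler0c ?invr_ge0.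
pose D := Y n.+1 x - Y n x; have {}IH : `|D| <= (q n.+1 - q n)%:C * `|x| by exact: IH.
(* The increment is half the difference of the squares of two successive iterates, which factors
   because they commute; [q] obeys the same identity. *)
have -> : Y n.+2 x - Y n.+1 x = (2^-1 : R[i]) *: (Y n.+1 D + Y n D).
  rewrite (YS n.+1) [in X in _ - X]YS -scalerBr.
  congr (_ *: _); rewrite {IH}/D; move: (lY n) (lY n.+1) (YY n n.+1 x).
  move: (Y n) (Y n.+1) => P Q lP lQ PQ; apply: ip_inj => z.
  by rewrite !lP !lQ !ipE PQ; ring.
have -> : (q n.+2 - q n.+1)%:C
    = (2^-1)%:C * ((q n.+1)%:C * (q n.+1 - q n)%:C + (q n)%:C * (q n.+1 - q n)%:C).
  have -> : q n.+2 - q n.+1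
    = 2^-1 * (q n.+1 * (q n.+1 - q n) + q n * (q n.+1 - q n)) by rewrite /=; field.
  by move: (q n) (q n.+1) => a b; rewrite rmorphM rmorphD 2!rmorphM.
rewrite half_norm -mulrA ler_wpM2l ?ler0c ?invr_ge0 // mulrDl.
apply: le_trans (ler_normD _ _) (lerD _ _); apply: le_trans (normY _ _) _;
  by rewrite -mulrA ler_wpM2l ?ler0c.
Qed.

Let cvgY x : exists l, hcvg (Y^~ x) l.
Proof.
apply: (@hcvg_domin _ _ _ (fun n => q n * Num.sqrt (nsq x)) (Num.sqrt (nsq x))).
- by move=> n; rewrite ler_wpM2r ?sqrtr_ge0.
- by move=> n; rewrite ler_piMl ?sqrtr_ge0.
- move=> n; rewrite -mulrBl rmorphM /= -normE; exact: normYS.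
Qed.

Lemma defect_exists : exists D : H -> H, adj D D /\ forall x, D (D x) = x - B x.
Proof.
have [Z hZ] := choice cvgY.
have aZ : adj Z Z by move=> x y; apply: hcvg_ip_eq (hZ x) (hZ y) (fun n => adjY n x y).
have lZ := linE (adj_linear aZ).
have cY n x : nsq (Y n x) <= nsq x.
  have := normY n x; rewrite le_norm_nsq // => /le_trans; apply.
  by rewrite ler_piMl ?nsq_ge0 // exprn_ile1.
(* This fixed-point equation is what makes [1 - Z] a square root:
   [(1 - Z)^2 = 1 - 2 Z + Z^2 = 1 - B]. *)
have ZE x : Z x = (2^-1 : R[i]) *: (B x + Z (Z x)).
  apply: (@hcvg_unique _ _ (fun n => Y n.+1 x)) => e e0.
    by have [N hN] := hZ x _ e0; exists N => n Nn; apply: hN; apply: leqW.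
  have [n1 h1] := hZ x _ e0; have [n2 h2] := hZ (Z x) _ e0.
  exists (maxn n1 n2) => n; rewrite geq_max => /andP[/h1 {}h1 /h2 {}h2].
  rewrite /= -scalerBr opprD addrACA subrr add0r nsqZ.
  have -> : Y n (Y n x) - Z (Z x) = Y n (Y n x - Z x) + (Y n (Z x) - Z (Z x)).
    by apply: ip_inj => z; rewrite !lY !ipE; ring.
  have -> : Re (2^-1 : R[i]) ^+ 2 + Im (2^-1 : R[i]) ^+ 2 = 4^-1.
    have -> : (2^-1 : R[i]) = (2^-1 : R)%:C by rewrite fmorphV rmorph_nat.
    by rewrite /=; field.
  have := nsqDle (Y n (Y n x - Z x)) (Y n (Z x) - Z (Z x)).
  have := cY n (Y n x - Z x); lra.
exists (fun x => x - Z x); split=> [x y|x]; first by rewrite !ipE aZ.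
have -> : B x = Z x *+ 2 - Z (Z x).
  rewrite {1}ZE -scaler_nat scalerA divff ?pnatr_eq0 // scale1r.
  by rewrite addrK.
by rewrite !lZ mulr2n; apply: ip_inj => y; rewrite !ipE; ring.
Qed.

End Defect.

(** * The Hilbert space of square-summable sequences *)

Section ComplexLimits.
Variable R : realType.
Implicit Types (u v : nat -> R[i]) (l k : R[i]).

(** Limits are taken on real and imaginary parts, where the convergence theorems for real series
    apply. *)
Definition ccvg u l : Prop :=
  (fun n => Re (u n)) @ \oo --> Re l /\ (fun n => Im (u n)) @ \oo --> Im l.

Lemma ccvg_unique u l k : ccvg u l -> ccvg u k -> l = k.
Proof.
move=> [h1 h2] [h3 h4].
apply/eqP; rewrite eq_complex; apply/andP; split; apply/eqP.
  exact: cvg_unique h1 h3.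
exact: cvg_unique h2 h4.
Qed.

Lemma ccvg_cst l : ccvg (fun=> l) l.
Proof. by split; exact: cvg_cst. Qed.

Lemma ccvgD u v l k : ccvg u l -> ccvg v k -> ccvg (fun n => u n + v n) (l + k).
Proof.
move=> [h1 h2] [h3 h4]; split; rewrite raddfD /=.
  by under eq_fun do rewrite raddfD; exact: cvgD.
by under eq_fun do rewrite raddfD; exact: cvgD.
Qed.

Lemma ccvgZ a u l : ccvg u l -> ccvg (fun n => a * u n) (a * l).
Proof.
move=> [h1 h2]; case: a => p q.
have E : forall z : R[i], Re ((p +i* q) * z) = p * Re z - q * Im z /\
    Im ((p +i* q) * z) = p * Im z + q * Re z by case.
split; rewrite ?(E l).1 ?(E l).2.
  under eq_fun do rewrite (E _).1.
  by apply: cvgB; apply: cvgMl_tmp.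
under eq_fun do rewrite (E _).2.
by apply: cvgD; apply: cvgMl_tmp.
Qed.

Lemma ccvgJ u l : ccvg u l -> ccvg (fun n => (u n)^*%C) (l^*%C).
Proof.
have E : forall z : R[i], Re (z^*%C) = Re z /\ Im (z^*%C) = - Im z by case.
move=> [h1 h2]; split; rewrite ?(E l).1 ?(E l).2.
  by under eq_fun do rewrite (E _).1.
by under eq_fun do rewrite (E _).2; exact: cvgN.
Qed.

Lemma ccvg_sub u l (s : nat -> nat) : (forall n, (n <= s n)%N) ->
  ccvg u l -> ccvg (fun n => u (s n)) l.
Proof.
move=> hs [h1 h2].
have sc : s @ \oo --> \oo.
  by move=> A [N _ hN]; exists N => // n /= Nn; apply: hN; apply: leq_trans Nn (hs n).
by split; [exact: cvg_comp sc h1|exact: cvg_comp sc h2].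
Qed.

End ComplexLimits.

Section SquareSummable.
Variables (R : realType) (E : hilbertType R).

Definition sqsum : {pred (nat -> E)} :=
  fun x => `[< exists M : R, forall N, \sum_(0 <= n < N) nsq (x n) <= M >].

Lemma sqsumP (x : nat -> E) :
  reflect (exists M : R, forall N, \sum_(0 <= n < N) nsq (x n) <= M)
    (x \in sqsum).
Proof. exact: asboolP. Qed.

Lemma sqsum_submod : subsemimod_closed sqsum.
Proof.
split; first split.
- apply/sqsumP; exists 0 => N; rewrite big1 // => i _; exact: nsq0.
- move=> x y /sqsumP[M hM] /sqsumP[M' hM']; apply/sqsumP.
  exists ((M + M') *+ 2) => N.
  apply: (@le_trans _ _ (\sum_(0 <= n < N) (nsq (x n) + nsq (y n)) *+ 2)).
    by apply: ler_sum => n _; exact: nsqDle.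
  rewrite sumrMnl big_split /= lerMn2r /=; exact: lerD.
- move=> a x /sqsumP[M hM]; apply/sqsumP.
  exists ((Re a ^+ 2 + Im a ^+ 2) * M) => N.
  under eq_bigr do rewrite nsqZ.
  by rewrite -mulr_sumr ler_wpM2l // addr_ge0 ?sqr_ge0.
Qed.

HB.instance Definition _ := GRing.isSubmodClosed.Build R[i] (nat -> E) sqsum
  sqsum_submod.

Record l2 := L2 { l2_fun :> nat -> E; l2_prop : l2_fun \in sqsum }.

HB.instance Definition _ := [isSub for l2_fun].
HB.instance Definition _ := [Choice of l2 by <:].
HB.instance Definition _ := [SubChoice_isSubLmodule of l2 by <:].

Lemma l2_ext (x y : l2) : (forall n, x n = y n) -> x = y.
Proof. by move=> h; apply/val_inj/funext. Qed.

Definition partial (x y : nat -> E) N : R[i] := \sum_(0 <= n < N) '[x n, y n].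

Lemma real_series_cvg (x y : l2) (v : nat -> R) :
  (forall n, `|v n| <= nsq (x n) + nsq (y n)) ->
  exists l : R, (fun N => \sum_(0 <= n < N) v n) @ \oo --> l.
Proof.
move=> hv; suff /cvg_ex[l hl] : cvgn (series v) by exists l.
apply: normed_cvg.
have [M hM] := sqsumP _ (l2_prop x); have [M' hM'] := sqsumP _ (l2_prop y).
apply: nondecreasing_is_cvgn.
  apply/nondecreasing_seqP => n.
  change (\sum_(0 <= k < n) `|v k| <= \sum_(0 <= k < n.+1) `|v k|).
  rewrite big_nat_recr //= lerDl.
  exact: normr_ge0.
exists (M + M') => _ [N _ <-]; rewrite /series /=.
apply: (@le_trans _ _ (\sum_(0 <= n < N) (nsq (x n) + nsq (y n)))).
  by apply: ler_sum => n _; exact: hv.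
by rewrite big_split /= lerD.
Qed.

(** Absolute convergence: by Cauchy-Schwarz each term is at most [nsq (x n) + nsq (y n)]. *)
Lemma partial_cvg (x y : l2) : exists w, ccvg (partial x y) w.
Proof.
have bnd n : `|Re '[x n, y n]| <= nsq (x n) + nsq (y n) /\
    `|Im '[x n, y n]| <= nsq (x n) + nsq (y n).
  have := Cauchy_Schwarz (x n) (y n).
  have := nsq_ge0 (x n); have := nsq_ge0 (y n).
  move: (nsq _) (nsq _) (Re _) (Im _) => p q a b p0 q0 h.
  have s0 : 0 <= p + q by lra.
  have a2 := sqr_ge0 a; have b2 := sqr_ge0 b.
  by split; rewrite -(@ler_pXn2r _ 2) ?nnegrE // real_normK ?num_real //; nra.
have [l1 h1] := real_series_cvg (fun n => (bnd n).1).
have [l2 h2] := real_series_cvg (fun n => (bnd n).2).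
exists (l1 +i* l2); split => /=.
  by under eq_fun do rewrite /partial raddf_sum.
by under eq_fun do rewrite /partial raddf_sum.
Qed.

(** The default 0 stands for no exceptional case, by [partial_cvg]. *)
Definition l2dot (x y : l2) : R[i] := xget 0 [set w | ccvg (partial x y) w].

Lemma l2dotP (x y : l2) : ccvg (partial x y) (l2dot x y).
Proof. by rewrite /l2dot; case: xgetP => // h; have [w /h] := partial_cvg x y. Qed.

Lemma l2dotE (x y : l2) w : ccvg (partial x y) w -> l2dot x y = w.
Proof. exact: ccvg_unique (l2dotP x y). Qed.

Lemma l2dot_herm (x y : l2) : l2dot x y = (l2dot y x)^*%C.
Proof.
apply: l2dotE; have := ccvgJ (l2dotP y x); congr (ccvg _ _).
by apply/funext => N; rewrite /partial rmorph_sum; apply: eq_bigr => n _; rewrite /= -ipC.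
Qed.

Lemma l2dot_linear (z : l2) a (x y : l2) :
  l2dot (a *: x + y) z = a * l2dot x z + l2dot y z.
Proof.
apply: l2dotE; have := ccvgD (ccvgZ a (l2dotP x z)) (l2dotP y z); congr (ccvg _ _).
apply/funext => N; rewrite /partial mulr_sumr -big_split /=; apply: eq_bigr => n _.
by rewrite -ipZl -ipDl.
Qed.

Lemma l2dot_bilinear :
  bilinear_for (GRing.mul : GRing.Scale.law R[i] R[i])
    (Num.conj \; GRing.mul : GRing.Scale.law R[i] R[i]) l2dot.
Proof.
split => z a x y; first exact: l2dot_linear.
by rewrite l2dot_herm l2dot_linear rmorphD rmorphM /= -!l2dot_herm.
Qed.

HB.instance Definition _ := bilinear_isBilinear.Build R[i] l2 l2 R[i] _ _ l2dot
  l2dot_bilinear.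

Lemma l2dot_hermitian (x y : l2) :
  l2dot x y = (-1) ^+ false * (Num.conj (l2dot y x)).
Proof. by rewrite expr0 mul1r l2dot_herm. Qed.

HB.instance Definition _ := isHermitianSesquilinear.Build R[i] l2 false Num.conj l2dot
  l2dot_hermitian.

Lemma l2nsq_ge (x : l2) N : \sum_(0 <= n < N) nsq (x n) <= Re (l2dot x x).
Proof.
have pE : (fun N => \sum_(0 <= n < N) nsq (x n)) = (fun N => Re (partial x x N)).
  by apply/funext => K; rewrite /partial raddf_sum.
have [h _] := l2dotP x x; rewrite -pE in h.
rewrite -(cvg_lim _ h) //; apply: (nondecreasing_cvgn_le _ (cvgP _ h)).
by apply/nondecreasing_seqP => n; rewrite big_nat_recr //= lerDl nsq_ge0.
Qed.

Lemma l2nsq_le (x : l2) M : (forall N, \sum_(0 <= n < N) nsq (x n) <= M) ->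
  Re (l2dot x x) <= M.
Proof.
move=> hM; have pE : (fun N => \sum_(0 <= n < N) nsq (x n)) = (fun N => Re (partial x x N)).
  by apply/funext => K; rewrite /partial raddf_sum.
have [h _] := l2dotP x x; rewrite -pE in h.
rewrite -(cvg_lim _ h) //; apply: limr_le; first exact: cvgP h.
by apply: nearW.
Qed.

Lemma l2dot_real (x : l2) : l2dot x x = (Re (l2dot x x))%:C.
Proof.
apply/eqP; rewrite eq_complex /= eqxx /=; have := l2dot_herm x x.
by case: (l2dot x x) => a b /= [] /eqP; rewrite -addr_eq0 -mulr2n mulrn_eq0.
Qed.

Lemma l2dot_pos (x : l2) : x != 0 -> 0 < l2dot x x.
Proof.
move=> x0; rewrite l2dot_real ltcR lt_neqAle eq_sym.
have nn : 0 <= Re (l2dot x x).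
  by have := l2nsq_ge x 0; rewrite big_geq.
rewrite nn andbT; apply: contra_neq x0 => h0; apply: l2_ext => n.
apply/nsq0_eq0/eqP; rewrite eq_le nsq_ge0 andbT -h0.
apply: le_trans (l2nsq_ge x n.+1); rewrite big_nat_recr //= lerDr.
by apply: sumr_ge0 => i _; exact: nsq_ge0.
Qed.

HB.instance Definition _ := isDotProduct.Build R[i] l2 l2dot l2dot_pos.

Definition l2nsq (x : l2) : R := Re (l2dot x x).

Lemma l2nsq_ge0 (x : l2) : 0 <= l2nsq x.
Proof. by have := l2nsq_ge x 0; rewrite big_geq. Qed.

Lemma l2nsqD (x y : l2) : l2nsq (x + y) = l2nsq x + l2nsq y + Re (l2dot x y) *+ 2.
Proof.
rewrite /l2nsq linearDl !linearDr /= (l2dot_herm y x).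
by case: (l2dot x y) => a b; rewrite !raddfD /=; ring.
Qed.

Definition l2norm (x : l2) : R[i] := (Num.sqrt (l2nsq x))%:C.

Lemma l2norm_triangle (x y : l2) : l2norm (x + y) <= l2norm x + l2norm y.
Proof.
rewrite /l2norm -rmorphD /= lecR.
have sxy : 0 <= Num.sqrt (l2nsq x) + Num.sqrt (l2nsq y).
  by rewrite addr_ge0 ?sqrtr_ge0.
rewrite -[leRHS]ger0_norm // -sqrtr_sqr ler_sqrt ?sqr_ge0 //.
rewrite sqrrD !sqr_sqrtr ?l2nsq_ge0 // l2nsqD addrAC lerD2r lerD2l lerMn2r /=.
rewrite -sqrtrM ?l2nsq_ge0 //; apply: le_trans (ler_norm _) _.
rewrite -sqrtr_sqr ler_sqrt ?mulr_ge0 ?l2nsq_ge0 //.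
apply: le_trans (dot_Cauchy_Schwarz l2dot x y).
by rewrite lerDl sqr_ge0.
Qed.

Lemma l2normZ a (x : l2) : l2norm (a *: x) = `|a| * l2norm x.
Proof.
rewrite /l2norm normc_def -rmorphM /= -sqrtrM ?addr_ge0 ?sqr_ge0 //.
congr (Num.sqrt _)%:C; rewrite /l2nsq linearZl_LR linearZr_LR /= l2dot_real.
by case: a => p q /=; ring.
Qed.

Lemma l2norm_eq0 (x : l2) : l2norm x = 0 -> x = 0.
Proof.
move=> [] /eqP; rewrite sqrtr_eq0 => n0; apply: contraTeq isT => x0.
by have := l2dot_pos x0; rewrite l2dot_real ltcR ltNge n0.
Qed.

HB.instance Definition _ := Lmodule_isNormed.Build R[i] l2
  l2norm_triangle l2normZ l2norm_eq0.

Lemma l2_normE (x : l2) : `|x| = (Num.sqrt (l2nsq x))%:C.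
Proof. by []. Qed.

Lemma l2_seq_complete (u : nat -> l2) :
  (forall e : R, 0 < e -> exists N, forall n m, (N <= n)%N -> (N <= m)%N ->
    l2nsq (u n - u m) <= e) ->
  exists l, forall e : R, 0 < e -> exists N, forall n, (N <= n)%N ->
    l2nsq (u n - l) <= e.
Proof.
move=> hu.
have coord_le (x : l2) k : nsq (x k) <= l2nsq x.
  apply: le_trans (l2nsq_ge x k.+1); rewrite big_nat_recr //= lerDr.
  by apply: sumr_ge0 => i _; exact: nsq_ge0.
have /choice[l hl] k : exists z, hcvg (fun n => u n k) z.
  apply: cvg_nsq => e e0; have [N hN] := hu e e0; exists N => n m Nn Nm.
  exact: le_trans (coord_le (u n - u m) k) (hN n m Nn Nm).
have sum_small K (d : R) : 0 < d -> exists M, forall m, (M <= m)%N ->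
    \sum_(0 <= k < K) nsq (u m k - l k) <= d.
  elim: K d => [|K IH] d d0; first by exists 0%N => m _; rewrite big_geq // ltW.
  have d2 : 0 < d / 2 by rewrite divr_gt0.
  have [M1 h1] := IH _ d2; have [M2 h2] := hl K _ d2.
  exists (maxn M1 M2) => m; rewrite geq_max => /andP[/h1 {}h1 /h2 {}h2].
  by rewrite big_nat_recr //= [d](splitr d) lerD.
(* The index [m] is chosen after [K], so the sum of [K] terms against the limit is small, while the
   final bound does not depend on [K]. *)
have tail (e : R) : 0 < e -> exists N, forall n K, (N <= n)%N ->
    \sum_(0 <= k < K) nsq (u n k - l k) <= e.
  move=> e0; have e4 : 0 < e / 4 by rewrite divr_gt0.
  have [N hN] := hu _ e4; exists N => n K Nn.
  have [M hM] := sum_small K _ e4.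
  have h1 := hM _ (leq_maxl M N); have h2 := hN n _ Nn (leq_maxr M N).
  set m := maxn M N in h1 h2.
  have h3 := le_trans (l2nsq_ge (u n - u m) K) h2.
  apply: (@le_trans _ _ (\sum_(0 <= k < K)
      (nsq ((u n - u m) k) + nsq (u m k - l k)) *+ 2)).
    apply: ler_sum => k _; apply: le_trans (nsqDle _ _).
    by have -> : u n k - l k = (u n - u m) k + (u m k - l k) by rewrite addrA subrK.
  rewrite sumrMnl big_split /=; lra.
have [N0 hN0] := tail 1 ltr01.
have dl : (u N0 : nat -> E) - l \in sqsum.
  by apply/sqsumP; exists 1 => K; exact: hN0.
have ll : l \in sqsum.
  have -> : l = (u N0 : nat -> E) - ((u N0 : nat -> E) - l) by rewrite opprB addrC subrK.
  by rewrite rpredB // l2_prop.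
exists (L2 ll) => e e0; have [N hN] := tail e e0; exists N => n Nn.
by apply: l2nsq_le => K; exact: hN.
Qed.

(** A Cauchy filter contains a ball of radius [1 / (n + 1)] for each [n]; the centres form a Cauchy
    sequence, whose limit is that of the filter. *)
Lemma l2_complete (F : set_system l2) : ProperFilter F -> cauchy F -> cvg F.
Proof.
move=> PF /cauchyP F_ex.
have norm_lt (x : l2) (e : R) : 0 < e -> (`|x| < e%:C) = (l2nsq x < e ^+ 2).
  move=> e0; rewrite l2_normE ltcR -{1}(ger0_norm (ltW e0)) -sqrtr_sqr ltr_sqrt //.
  by rewrite exprn_gt0.
have /choice[u hu] (n : nat) : exists x : l2, F (ball x (n.+1%:R^-1 : R)%:C).
  by apply: F_ex; rewrite ltcR invr_gt0 ltr0n.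
have small (e : R) : 0 < e -> exists N, forall n, (N <= n)%N -> n.+1%:R^-1 < e.
  move=> e0; exists (Num.truncn e^-1).+1 => n Nn.
  rewrite -[ltRHS]invrK ltf_pV2 ?posrE ?invr_gt0 ?ltr0n //.
  apply: (lt_le_trans (truncnS_gt _)).
  by rewrite ler_nat; apply: leq_trans Nn _.
have [l hl] : exists l, forall e : R, 0 < e -> exists N, forall n, (N <= n)%N ->
    l2nsq (u n - l) <= e.
  apply: l2_seq_complete => e e0.
  have s0 : 0 < Num.sqrt e / 2 by rewrite divr_gt0 ?sqrtr_gt0.
  have [N hN] := small _ s0; exists N => n m Nn Nm.
  have [z [zn zm]] := filter_ex (filterI (hu n) (hu m)).
  rewrite -(sqr_sqrtr (ltW e0)); apply/ltW; rewrite -norm_lt ?sqrtr_gt0 //.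
  have -> : u n - u m = (u n - z) - (u m - z) by rewrite opprB addrA subrK.
  apply: le_lt_trans (ler_normB _ _) _.
  move: zn zm; rewrite -!ball_normE /= => zn zm.
  apply: (lt_trans (ltrD zn zm)); rewrite -rmorphD /= ltcR.
  by rewrite [ltRHS]splitr; apply: ltrD; apply: hN.
apply/cvg_ex; exists l; apply/cvgrPdist_lt => e e0.
have [r0 er] : 0 < Re e /\ e = (Re e)%:C.
  by move: e0; case: (e) => a b; rewrite ltcE /= => /andP[/eqP -> ->].
have r2 : 0 < Re e / 2 by rewrite divr_gt0.
have r4 : 0 < (Re e / 4) ^+ 2 by rewrite exprn_gt0 // divr_gt0.
have [N1 h1] := hl _ r4; have [N2 h2] := small _ r2.
have {}h1 := h1 _ (leq_maxl N1 N2); have {}h2 := h2 _ (leq_maxr N1 N2).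
set n := maxn N1 N2 in h1 h2.
apply: filterS (hu n) => z; rewrite -ball_normE /=.
move: (n.+1%:R^-1 : R) h2 => c h2 hz.
have -> : l - z = (u n - z) - (u n - l) by rewrite opprB [RHS]addrC addrA subrK.
apply: le_lt_trans (ler_normB _ _) _.
rewrite er (_ : Re e = c + (Re e - c)); last by rewrite addrC subrK.
rewrite rmorphD /= ltrD // norm_lt; last by lra.
apply: le_lt_trans h1 _; rewrite ltr_pXn2r ?nnegrE //; lra.
Qed.

HB.instance Definition _ := Uniform_isComplete.Build l2 l2_complete.

Lemma l2dot_norm (x : l2) : `|x| ^+ 2 = l2dot x x.
Proof.
by rewrite l2_normE -rmorphXn /= sqr_sqrtr ?l2nsq_ge0 // -l2dot_real.
Qed.

Definition l2_hilbert : hilbertType R := @HilbertType R l2 l2dot l2dot_norm.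

End SquareSummable.

(** * Operators on sequences *)

Section SequenceOperators.
Variables (R : realType) (E : hilbertType R).

Definition coord (x : l2_hilbert E) n : E := (x : l2 E) n.

Lemma coordD x y n : coord (x + y) n = coord x n + coord y n. Proof. by []. Qed.
Lemma coordN x n : coord (- x) n = - coord x n. Proof. by []. Qed.
Lemma coordZ a x n : coord (a *: x) n = a *: coord x n. Proof. by []. Qed.
Lemma coord0 n : coord 0 n = 0. Proof. by []. Qed.

Definition coordE := (coordD, coordN, coordZ, coord0).

Lemma coord_ext x y : coord x =1 coord y -> x = y.
Proof. exact: l2_ext. Qed.

Lemma coord_sum_le x N : \sum_(0 <= n < N) nsq (coord x n) <= nsq x.
Proof. exact: l2nsq_ge. Qed.

Lemma coord_le x n : nsq (coord x n) <= nsq x.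
Proof.
apply: le_trans (coord_sum_le x n.+1); rewrite big_nat_recr //= lerDr.
by apply: sumr_ge0 => i _; exact: nsq_ge0.
Qed.

Lemma nsq_le_sum x M : (forall N, \sum_(0 <= n < N) nsq (coord x n) <= M) ->
  nsq x <= M.
Proof. exact: l2nsq_le. Qed.

Lemma coord_ip x y :
  ccvg (fun N => \sum_(0 <= n < N) '[coord x n, coord y n]) '[x, y].
Proof. exact: l2dotP. Qed.

(* Opaque, so that unification never unfolds sequence operators. *)
Lemma mkl2_subproof (f : nat -> E) : exists x : l2_hilbert E,
  f \in @sqsum R E -> coord x =1 f.
Proof.
have [fs|//] := boolP (f \in @sqsum R E); last by exists 0.
by exists (L2 fs).
Qed.

Definition mkl2 f := projT1 (cid (mkl2_subproof f)).

Lemma mkl2E f (M : R) : (forall N, \sum_(0 <= n < N) nsq (f n) <= M) ->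
  coord (mkl2 f) =1 f.
Proof.
move=> hf; apply: (projT2 (cid (mkl2_subproof f))).
by apply/sqsumP; exists M.
Qed.

(** Coordinate 0 is treated apart because it will hold the original space, and the later ones the
    defect blocks of the lifting. *)
Definition diag (F0 F : E -> E) (x : l2_hilbert E) : l2_hilbert E :=
  mkl2 (fun n => (if n is 0%N then F0 else F) (coord x n)).

Section Diagonal.
Variables (F0 F0' F F' : E -> E).
Hypotheses (hF0 : cpair F0 F0') (hF : cpair F F').

Let diag_sum (G0 G : E -> E) x N : contractive G0 -> contractive G ->
  \sum_(0 <= n < N) nsq ((if n is 0%N then G0 else G) (coord x n)) <= nsq x.
Proof.
move=> c0 c; apply: le_trans (coord_sum_le x N).
by apply: ler_sum => -[|n] _.
Qed.

Lemma diagE x n : coord (diag F0 F x) n = (if n is 0%N then F0 else F) (coord x n).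
Proof.
rewrite /diag (@mkl2E _ (nsq x)) // => N; apply: diag_sum; [exact: hF0.2|exact: hF.2].
Qed.

Lemma diag_contractive : contractive (diag F0 F).
Proof.
move=> x; apply: nsq_le_sum => N; under eq_bigr do rewrite diagE.
apply: diag_sum; [exact: hF0.2|exact: hF.2].
Qed.

End Diagonal.

Lemma diag_cpair F0 F0' F F' : cpair F0 F0' -> cpair F F' ->
  cpair (diag F0 F) (diag F0' F').
Proof.
move=> h0 h; split; last exact: diag_contractive h0 h.
move=> x y; apply: ccvg_unique (coord_ip _ _) _.
have := coord_ip x (diag F0' F' y); congr (ccvg _ _); apply/funext => N.
apply: eq_bigr => n _.
rewrite (diagE h0 h) (diagE (cpair_sym h0) (cpair_sym h)).
by case: n => [|n]; rewrite ?h0.1 ?h.1.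
Qed.

Section Reindexing.
Variables (s : nat -> nat) (r : nat -> option nat).
Hypothesis s_incr : forall n, (s n < s n.+1)%N.
Hypothesis r_s : forall n, r (s n) = Some n.
Hypothesis s_r : forall j n, r j = Some n -> s n = j.

Let s_mono n m : (n < m)%N -> (s n < s m)%N.
Proof. exact: (homo_ltn ltn_trans s_incr). Qed.

Let s_ge n : (n <= s n)%N.
Proof. by elim: n => // n IH; apply: leq_ltn_trans IH (s_incr n). Qed.

Lemma sum_reindex (V : nmodType) (f : nat -> V) N : (forall j, r j = None -> f j = 0) ->
  \sum_(0 <= j < s N) f j = \sum_(0 <= n < N) f (s n).
Proof.
move=> f0; have gap a b : (forall n, ~~ (a <= s n < b)%N) ->
    \sum_(a <= j < b) f j = 0.
  move=> hab; rewrite big_nat big1 // => j jab; apply: f0.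
  by case: (r j) (@s_r j) => // n /(_ n erefl) sn; have := hab n; rewrite sn jab.
elim: N => [|N IH].
  rewrite [RHS]big_geq //; apply: gap => n.
  rewrite -leqNgt /=; case: n => // n; exact: ltnW (s_mono _).
rewrite (@big_cat_nat _ _ _ (s N)) //=; last exact: ltnW.
rewrite IH big_nat_recr //=; congr (_ + _).
rewrite big_ltn // gap ?addr0 // => n.
apply/negP => /andP[h1 h2]; have [nN|Nn] := leqP n N.
  have : (s n <= s N)%N by move: nN; rewrite leq_eqVlt => /orP[/eqP->//|/s_mono/ltnW].
  by rewrite leqNgt h1.
have : (s N.+1 <= s n)%N by move: Nn; rewrite leq_eqVlt => /orP[/eqP->//|/s_mono/ltnW].
by rewrite leqNgt h2.
Qed.

(** The isometry induced by the increasing injection [s], with [r] the partial inverse of [s] and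
    [pull] the adjoint. The unilateral shift and both halves of the even-odd splitting are
    instances. *)
Definition push (x : l2_hilbert E) : l2_hilbert E :=
  mkl2 (fun j => if r j is Some n then coord x n else 0).

Definition pull (y : l2_hilbert E) : l2_hilbert E := mkl2 (fun n => coord y (s n)).

Let push_sum x N :
  \sum_(0 <= j < N) nsq (if r j is Some n then coord x n else 0) <= nsq x.
Proof.
apply: (@le_trans _ _
  (\sum_(0 <= j < s N) nsq (if r j is Some n then coord x n else 0))).
  rewrite (@big_cat_nat _ _ _ N 0 (s N)) //= lerDl.
  by apply: sumr_ge0 => i _; exact: nsq_ge0.
rewrite sum_reindex; last by move=> j ->; exact: nsq0.
by under eq_bigr do rewrite r_s; exact: coord_sum_le.
Qed.

Lemma pushE x j : coord (push x) j = if r j is Some n then coord x n else 0.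
Proof. by rewrite /push (mkl2E (push_sum x)). Qed.

Let pull_sum y N : \sum_(0 <= n < N) nsq (coord y (s n)) <= nsq y.
Proof.
apply: le_trans (coord_sum_le y (s N)).
pose f j := if r j is Some n then nsq (coord y j) else 0.
apply: (@le_trans _ _ (\sum_(0 <= j < s N) f j)).
  rewrite sum_reindex /f; last by move=> j ->.
  by apply: ler_sum => n _; rewrite r_s.
by apply: ler_sum => j _; rewrite /f; case: (r j) => //; exact: nsq_ge0.
Qed.

Lemma pullE y n : coord (pull y) n = coord y (s n).
Proof. by rewrite /pull (mkl2E (pull_sum y)). Qed.

Lemma push_cpair : cpair push pull.
Proof.
split=> [x y|x]; last by apply: nsq_le_sum => N; under eq_bigr do rewrite pushE.
(* Partial sums of length [s N] on one side equal those of length [N] on the other, so the first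
   limit is taken along [s]. *)
apply: ccvg_unique (ccvg_sub s_ge (coord_ip _ _)) _.
have := coord_ip x (pull y); congr (ccvg _ _); apply/funext => N.
rewrite sum_reindex; last by move=> j rj; rewrite pushE rj ip0l.
by apply: eq_bigr => n _; rewrite pullE pushE r_s.
Qed.

End Reindexing.

Definition inj0 (h : E) : l2_hilbert E := mkl2 (fun n => if n is 0%N then h else 0).

Lemma inj0E h n : coord (inj0 h) n = if n is 0%N then h else 0.
Proof.
rewrite /inj0 (@mkl2E _ (nsq h)) // => -[|N]; first by rewrite big_geq ?nsq_ge0.
by rewrite big_nat_recl //= big1 ?addr0 // => i _; exact: nsq0.
Qed.

Lemma inj0_cpair : cpair inj0 (coord^~ 0%N).
Proof.
split=> [h x|h].
  apply: (@ccvg_unique _ _ _ _ _ (ccvg_cst _)).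
  have := ccvg_sub leqnSn (coord_ip (inj0 h) x); congr (ccvg _ _); apply/funext => N.
  by rewrite big_nat_recl //= inj0E big1 ?addr0 // => i _; rewrite inj0E ip0l.
apply: nsq_le_sum => -[|N]; first by rewrite big_geq ?nsq_ge0.
rewrite big_nat_recl //= inj0E big1 ?addr0 // => i _; rewrite inj0E; exact: nsq0.
Qed.

Let pred_of j := if j is k.+1 then Some k else None.

Let pred_ofS j n : pred_of j = Some n -> n.+1 = j.
Proof. by case: j => // j [->]. Qed.

Definition shift := push pred_of.
Definition unshift := pull succn.

Lemma shiftE x j : coord (shift x) j = if j is k.+1 then coord x k else 0.
Proof. by rewrite (@pushE succn pred_of ltnSn (fun=> erefl) pred_ofS); case: j. Qed.

Lemma unshiftE x n : coord (unshift x) n = coord x n.+1.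
Proof. by rewrite (@pullE succn pred_of ltnSn (fun=> erefl) pred_ofS). Qed.

Lemma shift_cpair : cpair shift unshift.
Proof. exact: (@push_cpair succn pred_of ltnSn (fun=> erefl) pred_ofS). Qed.

(** Two isometries with complementary orthogonal ranges, which identify the space with the direct
    sum of two copies of itself. *)
Definition weave (b : bool) := push (fun j => if odd j == b then Some j./2 else None).
Definition unweave (b : bool) := pull (fun n => b + n.*2)%N.

Let weave_r (b : bool) n :
  (if odd (b + n.*2) == b then Some (b + n.*2)./2 else None) = Some n.
Proof. by rewrite half_bit_double oddD odd_double addbF oddb eqxx. Qed.

Let weave_s (b : bool) j n :
  (if odd j == b then Some j./2 else None) = Some n -> (b + n.*2 = j)%N.
Proof. by case: eqP => // <- [<-]; exact: odd_double_half. Qed.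

Let weave_incr (b : bool) n : (b + n.*2 < b + n.+1.*2)%N.
Proof. by rewrite ltn_add2l ltn_double. Qed.

Lemma weaveE b x j : coord (weave b x) j = if odd j == b then coord x j./2 else 0.
Proof.
rewrite (pushE (weave_incr b) (@weave_r b) (@weave_s b)).
by case: eqP.
Qed.

Lemma unweaveE b x n : coord (unweave b x) n = coord x (b + n.*2).
Proof. exact: (pullE (weave_incr b) (@weave_r b) (@weave_s b)). Qed.

Lemma weave_cpair b : cpair (weave b) (unweave b).
Proof. exact: (push_cpair (weave_incr b) (@weave_r b) (@weave_s b)). Qed.

Lemma unweaveK b c x : unweave b (weave c x) = if b == c then x else 0.
Proof.
apply: coord_ext => n; rewrite unweaveE weaveE oddD odd_double addbF oddb.
case: eqP => [->|]; last by rewrite coord0.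
by rewrite half_bit_double.
Qed.

Lemma weave_sum x : weave false (unweave false x) + weave true (unweave true x) = x.
Proof.
apply: coord_ext => n; rewrite coordE !weaveE !unweaveE.
rewrite -[in RHS](odd_double_half n).
by case: (odd n); rewrite /= ?add0r ?addr0.
Qed.

End SequenceOperators.

(** * Ando's theorem *)

Section PartialIsometry.
Variables (R : realType) (X Y : hilbertType R).

(** [gs y] represents [x |-> <S x, y>] along [L], a bounded functional because [L x] and [S x] have
    the same length. The orthogonality clause of [riesz] puts it in the closed range of [L], so it
    is unique and hence linear in [y]. Its adjoint [g] sends [L x] to [S x] and kills the
    complement. *)
Lemma partial_isometry_exists (L S : X -> Y) : linear L -> linear S ->
  (forall x y, '[L x, L y] = '[S x, S y]) ->
  exists g gs : Y -> Y, [/\ cpair g gs, forall x, g (L x) = S x,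
    forall x, gs (S x) = L x & forall y, gs (g (gs y)) = gs y].
Proof.
move=> lL lS eLS.
have /choice[gs hgs] y : exists z, [/\ forall x, '[S x, y] = '[L x, z],
    forall u, (forall x, '[L x, u] = 0) -> '[z, u] = 0 & nsq z <= nsq y].
  apply: (@riesz R Y X 0 L (fun x => '[S x, y]) (nsq y)) => [|a x x'|x].
    exact: nsq_ge0.
    by exists (a *: x + x'); rewrite lL lS ipDl ipZl.
  by rewrite /nsq eLS mulrC; exact: Cauchy_Schwarz.
have gsP x y : '[S x, y] = '[L x, gs y] by have [] := hgs y.
have gs_perp y u : (forall x, '[L x, u] = 0) -> '[gs y, u] = 0.
  by have [_ h _] := hgs y; exact: h.
have gs_lin : linear gs.
  move=> a y y'; apply/eqP; rewrite -subr_eq0; apply/eqP/nsq0_eq0.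
  set w := _ - _.
  have hw x : '[L x, w] = 0 by rewrite /w !ipE -!gsP !ipE; ring.
  by rewrite /nsq {1}/w ipBl ipDl ipZl !(gs_perp _ _ hw) mulr0 addr0 subr0.
have [y|g hg] := @adj_exists _ _ _ gs 1 ler01 gs_lin.
  by rewrite mul1r; have [] := hgs y.
have gsg : cpair gs g by split => // y; have [] := hgs y.
have gL x : g (L x) = S x.
  by apply: ip_inj => y; rewrite gsP -(adj_sym hg).
have gsS x : gs (S x) = L x.
  apply/eqP; rewrite -subr_eq0; apply/eqP/nsq0_eq0; set u := _ - _.
  have hu k : '[L k, u] = 0 by rewrite /u ipBr -gsP eLS subrr.
  by rewrite /nsq {1}/u ipBl hu gs_perp // subrr.
exists g, gs; split => // [|y]; first exact: cpair_sym.
apply: ip_inj => w; apply/eqP; rewrite -subr_eq0 hg (adj_sym hg) -ipBr.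
by rewrite gs_perp // => x; rewrite ipBr -gsP -hg gsS subrr.
Qed.

End PartialIsometry.

Section Julia.
Variables (R : realType) (Z : hilbertType R).
Variables (S S' : bool -> Z -> Z) (g gs : Z -> Z).
Hypothesis adjS : forall b, adj (S b) (S' b).
Hypothesis S'S : forall b c x, S' b (S c x) = if b == c then x else 0.
Hypothesis sumS : forall x, S false (S' false x) + S true (S' true x) = x.
Hypothesis gP : cpair g gs.
Hypothesis gK : forall x, gs (g (gs x)) = gs x.

(* The Julia operator [[g, 1 - g g^*], [1 - g^* g, - g^*]] of the partial
   isometry g, in the decomposition of Z given by S. *)
Definition julia (x : Z) : Z :=
  let a := S' false x in let b := S' true x in
  S false (g a + (b - g (gs b))) + S true (a - gs (g a) - gs b).

Definition julia_adj (x : Z) : Z :=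
  let a := S' false x in let b := S' true x in
  S false (gs a + (b - gs (g b))) + S true (a - g (gs a) - g b).

Let gK' x : g (gs (g x)) = g x.
Proof.
by apply: ip_inj => z; rewrite gP.1 (adj_sym gP.1) gP.1 gK -gP.1.
Qed.

Let lS b := linE (adj_linear (adjS b)).
Let lS' b := linE (adj_linear (adj_sym (adjS b))).
Let lg := linE (adj_linear gP.1).
Let lgs := linE (adj_linear (adj_sym gP.1)).

Lemma julia_adjP : adj julia julia_adj.
Proof.
move=> x y; rewrite /julia /julia_adj !ipDl !ipDr !adjS -!(adj_sym (adjS _)).
by rewrite !ipE -!(adj_sym gP.1, gP.1); ring.
Qed.

Let S'comb b x y : S' b (S false x + S true y) = if b then y else x.
Proof. by rewrite lS' !S'S; case: b; rewrite ?addr0 ?add0r. Qed.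

(** From [g gs g = g], the defects [1 - gs g] and [1 - g gs] are projections: the diagonal entries
    add up to 1 and the off-diagonal ones cancel. *)
Lemma juliaK x : julia_adj (julia x) = x.
Proof.
rewrite /julia_adj /julia !S'comb -[RHS]sumS; congr (S _ _ + S _ _);
  apply: ip_inj => z; rewrite !(lg, lgs, gK, gK', ipE); ring.
Qed.

Lemma julia_adjK x : julia (julia_adj x) = x.
Proof.
rewrite /julia_adj /julia !S'comb -[RHS]sumS; congr (S _ _ + S _ _);
  apply: ip_inj => z; rewrite !(lg, lgs, gK, gK', ipE); ring.
Qed.

(** On the initial space of [g] the defect entry [1 - gs g] vanishes, so the Julia operator extends
    the partial isometry. *)
Lemma julia_false x : gs (g x) = x -> julia (S false x) = S false (g x).
Proof.
move=> h; rewrite /julia !S'S /= h subrr !(lg, lgs, lS) /=.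
by rewrite ?subr0 ?addr0.
Qed.

End Julia.

Section Toeplitz.
Variables (R : realType) (Z : hilbertType R).
Implicit Types T C A B : Z -> Z.

(** Lower bidiagonal block matrix: [B] on the diagonal and [A] below it, replaced by [T] and [C] in
    column 0. *)
Definition toeplitz T C A B (x : l2_hilbert Z) : l2_hilbert Z :=
  shift (diag C A x) + diag T B x.

Definition toeplitz_adj T C A B (y : l2_hilbert Z) : l2_hilbert Z :=
  diag C A (unshift y) + diag T B y.

Section Pairs.
Variables (T T' C C' A A' B B' : Z -> Z).
Hypotheses (hT : cpair T T') (hC : cpair C C') (hA : cpair A A') (hB : cpair B B').

Lemma toeplitzE x n : coord (toeplitz T C A B x) n =
  if n is k.+1 then (if k is 0%N then C else A) (coord x k) + B (coord x n)
  else T (coord x 0%N).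
Proof.
rewrite /toeplitz coordD shiftE (diagE hT hB).
by case: n => [|n]; rewrite ?add0r // (diagE hC hA).
Qed.

Lemma toeplitz_adjE y n : coord (toeplitz_adj T' C' A' B' y) n =
  if n is k.+1 then A' (coord y n.+1) + B' (coord y n)
  else C' (coord y 1) + T' (coord y 0%N).
Proof.
rewrite /toeplitz_adj coordD (diagE (cpair_sym hC) (cpair_sym hA)) unshiftE.
by rewrite (diagE (cpair_sym hT) (cpair_sym hB)); case: n.
Qed.

Lemma toeplitz_adjP : adj (toeplitz T C A B) (toeplitz_adj T' C' A' B').
Proof.
apply: adjD; last exact: (diag_cpair hT hB).1.
exact: adj_comp (diag_cpair hC hA).1 (shift_cpair _).1.
Qed.

Let lA' := linE (adj_linear (cpair_sym hA).1).
Let lB' := linE (adj_linear (cpair_sym hB).1).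
Let lC' := linE (adj_linear (cpair_sym hC).1).
Let lT' := linE (adj_linear (cpair_sym hT).1).

(** The hypotheses say that the columns are orthonormal: each has two entries, and only neighbouring
    columns share a row. *)
Lemma toeplitz_isometry :
  (forall x, C' (C x) + T' (T x) = x) -> (forall x, A' (A x) + B' (B x) = x) ->
  (forall x, C' (B x) = 0) -> (forall x, A' (B x) = 0) ->
  (forall x, B' (C x) = 0) -> (forall x, B' (A x) = 0) ->
  forall x, toeplitz_adj T' C' A' B' (toeplitz T C A B x) = x.
Proof.
move=> CT AB CB AB0 BC BA x; apply: coord_ext => n.
rewrite toeplitz_adjE !toeplitzE; case: n => [|[|n]].
- by rewrite lC' CB addr0 CT.
- by rewrite lA' lB' AB0 BC addr0 add0r AB.
- by rewrite lA' lB' AB0 BA addr0 add0r AB.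
Qed.

(** Row 0 of the matrix contains only [T]; this is what makes the adjoint of the lifting extend
    [T']. *)
Lemma toeplitz_adj_inj0 z : toeplitz_adj T' C' A' B' (inj0 z) = inj0 (T' z).
Proof.
apply: coord_ext => n; rewrite toeplitz_adjE !inj0E.
by case: n => [|n]; rewrite ?(lA', lB', lC') ?add0r.
Qed.

End Pairs.

(** The six equations compare the entries of both products at (0,0), (1,0), (n,n), (2,0), (n+1,n)
    and (n+2,n), for n >= 1. *)
Lemma toeplitz_comm T C A B U D E F T' C' A' B' U' D' E' F' :
  cpair T T' -> cpair C C' -> cpair A A' -> cpair B B' ->
  cpair U U' -> cpair D D' -> cpair E E' -> cpair F F' ->
  (forall x, T (U x) = U (T x)) ->
  (forall x, C (U x) + B (D x) = D (T x) + F (C x)) ->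
  (forall x, B (F x) = F (B x)) -> (forall x, A (D x) = E (C x)) ->
  (forall x, A (F x) + B (E x) = E (B x) + F (A x)) ->
  (forall x, A (E x) = E (A x)) ->
  commuting_ops (toeplitz T C A B) (toeplitz U D E F).
Proof.
move=> hT hC hA hB hU hD hE hF TU CU BF AD AF AE.
have lA := linE (adj_linear hA.1); have lB := linE (adj_linear hB.1).
have lE := linE (adj_linear hE.1); have lF := linE (adj_linear hF.1).
move: (toeplitzE hT hC hA hB) (toeplitzE hU hD hE hF).
move: (toeplitz T C A B) (toeplitz U D E F) => P Q PE QE x.
apply: coord_ext => n; rewrite !(PE, QE).
have assoc (a b c d a' b' c' d' : Z) : a = a' -> d = d' -> b + c = b' + c' ->
    a + b + (c + d) = a' + b' + (c' + d').
  by move=> -> -> h; rewrite addrA -(addrA a') h !addrA.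
case: n => [|[|[|n]]]; rewrite ?(PE, QE) ?(lA, lB, lE, lF) //.
- by rewrite !addrA CU BF.
- exact: assoc.
- exact: assoc.
Qed.

End Toeplitz.

Section Ando.
Variables (R : realType) (Z : hilbertType R) (J J' : bool -> Z -> Z).
Hypothesis JP : forall b, cpair (J b) (J' b).
Hypothesis J'J : forall b c x, J' b (J c x) = if b == c then x else 0.
Hypothesis sumJ : forall x, J false (J' false x) + J true (J' true x) = x.

Let lJ b := linE (adj_linear (JP b).1).
Let lJ' b := linE (adj_linear (cpair_sym (JP b)).1).

(** [J b] inside each half. A pair such as [(D1 T2 x, D2 x)] enters a block through [S false], each
    component filling the [false] part of its own half; the range of [S true] is the room for the
    Julia operator. *)
Let S b x := J false (J b (J' false x)) + J true (J b (J' true x)).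
Let S' b x := J false (J' b (J' false x)) + J true (J' b (J' true x)).

Let J'comb b x y : J' b (J false x + J true y) = if b then y else x.
Proof. by rewrite lJ' !J'J; case: b; rewrite ?addr0 ?add0r. Qed.

Let adjS b : adj (S b) (S' b).
Proof.
move=> x y; rewrite /S /S' !ipE !(JP _).1 -!(adj_sym (JP _).1).
by [].
Qed.

Let S'S b c x : S' b (S c x) = if b == c then x else 0.
Proof.
rewrite /S' /S !J'comb !J'J; case: eqP => // _.
by rewrite !lJ addr0.
Qed.

Let sumS x : S false (S' false x) + S true (S' true x) = x.
Proof.
rewrite /S /S' !J'comb -[RHS]sumJ -[in RHS](sumJ (J' false x)) -[in RHS](sumJ (J' true x)).
by rewrite !lJ !addrA; congr (_ + _); rewrite addrAC.
Qed.

(* V1 = G W1 and V2 = W2 G^-1, where W_i shifts by half a block,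
   (x, z_0, z_1, ...) |-> (T_i x, D_i x, z_0, z_1, ...) with D_i^2 = 1 - T_i^* T_i,
   and the unitary G acts on each block. Commutation only requires
   G (D_1 T_2 x, D_2 x) = (D_2 T_1 x, D_1 x), an isometric prescription whose
   Julia extension is G. A block is one copy of Z, split by J into halves. *)
Lemma ando_room (T1 T1' T2 T2' : Z -> Z) : cpair T1 T1' -> cpair T2 T2' ->
  commuting_ops T1 T2 ->
  exists V1 V1' V2 V2' : l2_hilbert Z -> l2_hilbert Z,
  [/\ adj V1 V1' /\ adj V2 V2',
      (forall x, V1' (V1 x) = x) /\ (forall x, V2' (V2 x) = x),
      commuting_ops V1 V2 &
      (forall z, V1' (inj0 z) = inj0 (T1' z)) /\
      (forall z, V2' (inj0 z) = inj0 (T2' z))].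
Proof.
move=> h1 h2 T12.
have defect (T T' : Z -> Z) : cpair T T' ->
    exists D : Z -> Z, cpair D D /\ forall x, D (D x) = x - T' (T x).
  move=> h; have [D [aD DD]] := defect_exists h; exists D; split => //; split => // x.
  rewrite /nsq aD DD ipBr -h.1 raddfB /= gerBl; exact: nsq_ge0.
have [D1 [c1 DD1]] := defect _ _ h1; have [D2 [c2 DD2]] := defect _ _ h2.
pose L x := J false (D1 (T2 x)) + J true (D2 x).
pose M x := J false (D2 (T1 x)) + J true (D1 x).
have ipJ a b c d : '[J false a + J true b, J false c + J true d] = '[a, c] + '[b, d].
  by rewrite ipDl !(JP _).1 !J'comb.
have lin_comb (F F1 G G1 : Z -> Z) : adj F F1 -> adj G G1 ->
    linear (fun x => J false (F x) + J true (G x)).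
  move=> hF hG a x y; rewrite (linE (adj_linear hF)) (linE (adj_linear hG)).
  rewrite (linE (adj_linear hF)) (linE (adj_linear hG)).
  by rewrite !lJ scalerDr addrACA.
have lL : linear L by apply: lin_comb (adj_comp h2.1 c1.1) c2.1.
have lM : linear M by apply: lin_comb (adj_comp h1.1 c2.1) c1.1.
(* The middle terms telescope: both sides equal [<x, y> - <T1 T2 x, T1 T2 y>]. *)
have LM x y : '[L x, L y] = '[M x, M y].
  rewrite /L /M !ipJ c1.1 c2.1 c1.1 c2.1 !DD1 !DD2 !ipBr -!h1.1 -!h2.1 !T12.
  by ring.
have [g [gs [gP gL gsM gK]]] := partial_isometry_exists lL lM LM.
pose G := julia S S' g gs; pose G' := julia_adj S S' g gs.
have G'G x : G' (G x) = x by exact: (juliaK adjS S'S sumS gP gK).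
have GG' x : G (G' x) = x by exact: (julia_adjK adjS S'S sumS gP gK).
have GP : cpair G G'.
  split; first exact: (julia_adjP adjS gP).
  apply: isometry_contractive G'G; exact: (julia_adjP adjS gP).
have lG := linE (adj_linear GP.1).
have lG' := linE (adj_linear (cpair_sym GP).1).
have GLM x : G (J false (J false (D1 (T2 x))) + J true (J false (D2 x))) =
    J false (J false (D2 (T1 x))) + J true (J false (D1 x)).
  have -> : J false (J false (D1 (T2 x))) + J true (J false (D2 x)) = S false (L x).
    by rewrite /S /L !J'comb.
  by rewrite /G (julia_false adjS S'S gP) ?gL ?gsM // /S /M !J'comb.
have J'P b := cpair_sym (JP b).
have pC1 := cpair_comp c1 (cpair_comp (cpair_comp (JP false) (JP false)) GP).
have pC2 := cpair_comp c2 (cpair_comp (JP false) (JP false)).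
have pA1 := cpair_comp (cpair_comp (J'P true) (JP false)) GP.
have pB1 := cpair_comp (cpair_comp (J'P false) (JP true)) GP.
have pA2 := cpair_comp (cpair_sym GP) (cpair_comp (J'P true) (JP false)).
have pB2 := cpair_comp (cpair_sym GP) (cpair_comp (J'P false) (JP true)).
have l1 := linE (adj_linear c1.1); have l2 := linE (adj_linear c2.1).
have Jb b x : J' b (J b x) = x by rewrite J'J eqxx.
have J01 x : J' false (J true x) = 0 by rewrite J'J.
have J10 x : J' true (J false x) = 0 by rewrite J'J.
pose simp := (G'G, Jb, J01, J10, (lJ false).2, (lJ true).2, (lJ' false).2,
  lG.2, l1.2, l2.2).
have V1P := toeplitz_adjP h1 pC1 pA1 pB1.
have V2P := toeplitz_adjP h2 pC2 pA2 pB2.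
have V1K := toeplitz_isometry h1 pC1 pA1 pB1.
have V2K := toeplitz_isometry h2 pC2 pA2 pB2.
have V12 := toeplitz_comm h1 pC1 pA1 pB1 h2 pC2 pA2 pB2 T12.
(* A half-block shift moves the [false] half of a block to its own [true] half (diagonal entry) and
   the [true] half to the [false] half of the next block (subdiagonal entry). On blocks, [V1]
   applies [G] after the shift and [V2] applies [G'] before it. *)
exists (toeplitz T1 (G \o (J false \o J false) \o D1) (G \o (J false \o J' true))
  (G \o (J true \o J' false))).
exists (toeplitz_adj T1' (D1 \o ((J' false \o J' false) \o G'))
  ((J true \o J' false) \o G') ((J false \o J' true) \o G')).
exists (toeplitz T2 ((J false \o J false) \o D2) ((J false \o J' true) \o G')
  ((J true \o J' false) \o G')).
exists (toeplitz_adj T2' (D2 \o (J' false \o J' false))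
  (G \o (J true \o J' false)) (G \o (J false \o J' true))).
split => //.
- split; [apply: V1K|apply: V2K] => x /=; rewrite !simp //.
  + by rewrite DD1 subrK.
  + by rewrite addrC sumJ.
  + by rewrite DD2 subrK.
  + by rewrite -lG (addrC (J true _)) sumJ GG'.
- apply: V12 => x /=; rewrite !simp //.
  (* Entry (1,0), the one that dictates the prescription for [G]. *)
  + by rewrite -lG GLM.
  + by rewrite -lG !sumJ GG'.
- split=> z; first exact: (toeplitz_adj_inj0 h1 pC1 pA1 pB1).
  exact: (toeplitz_adj_inj0 h2 pC2 pA2 pB2).
Qed.

End Ando.

(** [H] may be too small to be split into two copies of itself, so the construction runs on
    [l2_hilbert H], each operator being extended by 0 off coordinate 0. On the copy of [H] the
    adjoints are unchanged. *)
Theorem ando (R : realType) (H : hilbertType R) (T1 T1' T2 T2' : H -> H) :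
  cpair T1 T1' -> cpair T2 T2' -> commuting_ops T1 T2 ->
  exists (K : hilbertType R) (V : H -> K) (V1 V1' V2 V2' : K -> K),
  [/\ isometric_embedding V,
      adj V1 V1' /\ adj V2 V2',
      (forall x, V1' (V1 x) = x) /\ (forall x, V2' (V2 x) = x),
      commuting_ops V1 V2 &
      (forall h, V1' (V h) = V (T1' h)) /\ (forall h, V2' (V h) = V (T2' h))].
Proof.
move=> h1 h2 T12.
have ext (T T' : H -> H) (h : cpair T T') :=
  cpair_comp (cpair_comp (cpair_sym (inj0_cpair H)) h) (inj0_cpair H).
have [|V1 [V1' [V2 [V2' [aV iV cV [eV1 eV2]]]]]] := ando_room
    (@weave_cpair R H) (@unweaveK R H) (@weave_sum R H) (ext _ _ h1) (ext _ _ h2).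
  by move=> x /=; rewrite !inj0E T12.
exists (l2_hilbert (l2_hilbert H)), (fun h => inj0 (inj0 h)), V1, V1', V2, V2'.
split=> //; first split.
- exact: adj_linear (adj_comp (inj0_cpair H).1 (inj0_cpair (l2_hilbert H)).1).
- by move=> x y; rewrite (inj0_cpair _).1 inj0E (inj0_cpair _).1 inj0E.
- by split=> h; rewrite ?eV1 ?eV2 /= inj0E.
Qed.

(** * Unitary extension of commuting isometries *)

(** Closedness of [M] is expressed as stability under the double orthogonal complement, the form in
    which [riesz] locates its vector. *)
Lemma projection_exists (R : realType) (H : hilbertType R) (M : H -> Prop) :
  (forall a x y, M x -> M y -> M (a *: x + y)) -> M 0 ->
  (forall z, (forall u, (forall x, M x -> '[x, u] = 0) -> '[z, u] = 0) -> M z) ->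
  exists P : H -> H, [/\ adj P P, forall x, M (P x) & forall x, M x -> P x = x].
Proof.
move=> M_lin M0 M_perp2.
have /choice[P hP] y : exists z, M z /\ forall x, M x -> '[x, y] = '[x, z].
  have [|a [x Mx] [x' Mx']|[x Mx]|z [hz zM _]] :=
    @riesz R H {x | M x} (exist _ 0 M0) sval (fun x => '[sval x, y]) (nsq y).
  - exact: nsq_ge0.
  - by exists (exist _ _ (M_lin a _ _ Mx Mx')); rewrite /= ipDl ipZl.
  - by rewrite mulrC; exact: Cauchy_Schwarz.
  - exists z; split; last by move=> x Mx; exact: (hz (exist _ x Mx)).
    by apply: M_perp2 => u hu; apply: zM => -[x Mx]; exact: hu.
have MP x : M (P x) by have [] := hP x.
have ipP x y : M x -> '[x, y] = '[x, P y] by have [_ h] := hP y; exact: h.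
have aP : adj P P.
  by move=> x y; rewrite (ipP (P x)) // ipC -(ipP (P y)) // -ipC.
exists P; split => // x Mx; apply/eqP; rewrite -subr_eq0; apply/eqP/nsq0_eq0.
have h y : M y -> '[y, P x - x] = 0 by move=> My; rewrite ipBr -ipP // subrr.
by rewrite /nsq ipBl !h // subrr.
Qed.

(** [X X'] is a projection, so [nsq (v - X (X' v)) = nsq v - nsq (X' v)]. *)
Lemma isometry_range (R : realType) (H : hilbertType R) (X X' : H -> H) v :
  adj X X' -> (forall x, X' (X x) = x) -> nsq (X' v) = nsq v -> X (X' v) = v.
Proof.
move=> aX iX nv; apply/eqP; rewrite eq_sym -subr_eq0; apply/eqP/nsq0_eq0.
have h1 : '[v, X (X' v)] = '[X' v, X' v] by rewrite (adj_sym aX).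
have h2 : nsq (X (X' v)) = nsq (X' v) by rewrite /nsq aX iX.
by rewrite nsqB h1 h2 -/(nsq _) nv; ring.
Qed.

Lemma adj_commuting (R : realType) (H : hilbertType R) (A A' B B' : H -> H) :
  adj A A' -> adj B B' -> commuting_ops A B -> commuting_ops A' B'.
Proof.
by move=> hA hB AB x; apply: ip_inj2 => y; rewrite -hA -!hB -hA AB.
Qed.

(* On the range intersection M of the powers of X1 X2, a reducing subspace,
   both isometries are unitary. The inverses are extended by the identity on
   the orthogonal complement of M. *)
Lemma unitary_part (R : realType) (L : hilbertType R) (X1 X1' X2 X2' : L -> L) :
  adj X1 X1' -> adj X2 X2' -> (forall x, X1' (X1 x) = x) ->
  (forall x, X2' (X2 x) = x) -> commuting_ops X1 X2 ->
  exists U1 U1' U2 U2' : L -> L,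
  [/\ adj U1 U1' /\ adj U2 U2',
      (forall x, U1' (U1 x) = x) /\ (forall x, U2' (U2 x) = x),
      (forall x, U1 (U1' x) = x) /\ (forall x, U2 (U2' x) = x),
      commuting_ops U1 U2 &
      forall v, (forall n, exists y, v = iter n (X1 \o X2) y) ->
        U1 v = X1' v /\ U2 v = X2' v].
Proof.
move=> a1 a2 i1 i2 c12.
pose X := X1 \o X2; pose X' := X2' \o X1'.
have aX : adj X X' by exact: adj_comp a2 a1.
have XE x : X x = X1 (X2 x) by [].
have XE' x : X x = X2 (X1 x) by rewrite XE c12.
have X'X x : X' (X x) = x by rewrite /X' /= XE i1 i2.
have aXn n : adj (iter n X) (iter n X') by exact: adj_iter.
have iXn n x : iter n X' (iter n X x) = x.
  by elim: n x => // n IH x; rewrite iterSr [iter n.+1 X x]iterS X'X IH.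
have XX1 n x : iter n X (X1 x) = X1 (iter n X x).
  by elim: n => //= n ->; rewrite !XE -c12.
have XX2 n x : iter n X (X2 x) = X2 (iter n X x).
  by elim: n => //= n ->; rewrite !XE c12.
pose M v := forall n, exists y, v = iter n X y.
have ME v : M v -> forall n, iter n X (iter n X' v) = v.
  by move=> Mv n; have [y ->] := Mv n; rewrite iXn.
have [||z hz|P [aP MP PM]] := @projection_exists R L M.
- move=> a x y Mx My n; exists (a *: iter n X' x + iter n X' y).
  by rewrite (adj_linear (aXn n)) !ME.
- by move=> n; exists 0; rewrite (linE (adj_linear (aXn n))).
(* [1 - X^n X'^n] is self-adjoint and maps every [w] into the complement of [M]. As [z] is
   orthogonal to that complement, [X^n X'^n] fixes [z]. *)
- move=> n; exists (iter n X' z); apply: ip_inj => w; apply/eqP.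
  rewrite -subr_eq0 (aXn n) (adj_sym (aXn n)) -ipBr hz // => x Mx.
  by rewrite ipBr -(adj_sym (aXn n)) -(aXn n) ME // subrr.
have lP := linE (adj_linear aP).
have PP x : P (P x) = P x by exact: PM.
have M1 v : M v -> M (X1 v) by move=> Mv n; have [y ->] := Mv n; exists (X1 y).
have M2 v : M v -> M (X2 v) by move=> Mv n; have [y ->] := Mv n; exists (X2 y).
have M1' v : M v -> M (X1' v) /\ X1 (X1' v) = v.
  move=> Mv; split; last by have [y ->] := Mv 1; rewrite /= XE i1.
  (* Cancelling [X1] uses up one factor [X1 X2], hence the exponent [n.+1]. *)
  by move=> n; have [y ->] := Mv n.+1; exists (X2 y); rewrite /= XE i1 XX2.
have M2' v : M v -> M (X2' v) /\ X2 (X2' v) = v.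
  move=> Mv; split; last by have [y ->] := Mv 1; rewrite /= XE' i2.
  by move=> n; have [y ->] := Mv n.+1; exists (X1 y); rewrite /= XE' i2 XX1.
have commP (Y Y' : L -> L) : adj Y Y' -> (forall v, M v -> M (Y v)) ->
    (forall v, M v -> M (Y' v)) -> forall x, P (Y x) = Y (P x).
  move=> aY MY MY' x; apply: ip_inj => w.
  rewrite aP aY -(PM (Y' (P w))); last by apply/MY'/MP.
  by rewrite -aP -aY -aP PM //; apply/MY/MP.
pose U (Y : L -> L) x := Y (P x) + (x - P x).
have aU (Y Y' : L -> L) : adj Y Y' -> (forall x, P (Y x) = Y (P x)) -> adj (U Y) (U Y').
  by move=> aY PY x y; rewrite /U !ipE -PY !aP aY; ring.
have PU (Y : L -> L) : (forall x, P (Y x) = Y (P x)) -> forall x, P (U Y x) = Y (P x).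
  by move=> PY x; rewrite /U !lP -PY !PP subrr addr0.
have UU (Y Y' : L -> L) x : (forall x, P (Y' x) = Y' (P x)) ->
    U Y (U Y' x) = Y (Y' (P x)) + (x - P x).
  by move=> PY; rewrite {1}/U PU // /U [Y' (P x) + _]addrC addrK.
have UK (Y Y' : L -> L) : (forall x, P (Y x) = Y (P x)) ->
    (forall v, M v -> Y' (Y v) = v) ->
    forall x, U Y' (U Y x) = x.
  by move=> PY YK x; rewrite UU // YK // addrC subrK.
have P1 := commP _ _ a1 M1 (fun v Mv => (M1' v Mv).1).
have P2 := commP _ _ a2 M2 (fun v Mv => (M2' v Mv).1).
have P1' := commP _ _ (adj_sym a1) (fun v Mv => (M1' v Mv).1) M1.
have P2' := commP _ _ (adj_sym a2) (fun v Mv => (M2' v Mv).1) M2.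
have c12' := adj_commuting a1 a2 c12.
exists (U X1'), (U X1), (U X2'), (U X2); split.
- by split; apply: aU => //; exact: adj_sym.
- by split; apply: UK => // v Mv; [have [] := M1' v Mv|have [] := M2' v Mv].
- by split; apply: UK.
- by move=> x; rewrite !UU // c12'.
- by move=> v Mv; rewrite /U (PM v Mv) subrr !addr0.
Qed.

Theorem unitary_extension (R : realType) (K : hilbertType R) (V1 V1' V2 V2' : K -> K) :
  adj V1 V1' -> adj V2 V2' -> (forall x, V1' (V1 x) = x) ->
  (forall x, V2' (V2 x) = x) -> commuting_ops V1 V2 ->
  exists (L : hilbertType R) (J : K -> L) (U1 U1' U2 U2' : L -> L),
  [/\ isometric_embedding J,
      adj U1 U1' /\ adj U2 U2',
      (forall x, U1' (U1 x) = x) /\ (forall x, U2' (U2 x) = x),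
      (forall x, U1 (U1' x) = x) /\ (forall x, U2 (U2' x) = x) &
      commuting_ops U1 U2 /\
      ((forall k, U1 (J k) = J (V1 k)) /\ (forall k, U2 (J k) = J (V2 k)))].
Proof.
move=> a1 a2 i1 i2 c12.
have cp (V V' : K -> K) : adj V V' -> (forall x, V' (V x) = x) -> cpair V' V.
  by move=> aV iV; apply: cpair_sym; split => //; exact: isometry_contractive iV.
have [L [J [X1 [X1' [X2 [X2' [isoJ [aX1 aX2] [iX1 iX2] cX [e1 e2]]]]]]]] :=
  ando (cp _ _ a1 i1) (cp _ _ a2 i2) (adj_commuting a1 a2 c12).
have [U1 [U1' [U2 [U2' [aU UK KU cU ext]]]]] := unitary_part aX1 aX2 iX1 iX2 cX.
exists L, J, U1, U1', U2, U2'; split => //.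
have nJ k : nsq (J k) = nsq k by rewrite /nsq isoJ.2.
(* [X1' (J k) = J (V1 k)] is as long as [J k], which forces [J k] into the range of [X1]. With the
   same for [X2], iteration puts the copy of [K] into the range of every power of [X1 X2], where
   [Ui] agrees with [Xi']. *)
have ran1 k : X1 (J (V1 k)) = J k.
  by rewrite -e1; apply: isometry_range aX1 iX1 _; rewrite e1 !nJ /nsq a1 i1.
have ran2 k : X2 (J (V2 k)) = J k.
  by rewrite -e2; apply: isometry_range aX2 iX2 _; rewrite e2 !nJ /nsq a2 i2.
have ran n k : exists y, J k = iter n (X1 \o X2) y.
  elim: n k => [|n IH] k; first by exists (J k).
  by have [y yE] := IH (V2 (V1 k)); exists y; rewrite /= -yE ran2 ran1.
by split=> //; split=> k; rewrite ?(ext _ (ran^~ k)).1 ?(ext _ (ran^~ k)).2.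
Qed.

(** * The joint spectrum *)

Section Koszul.
Variables (R : realType) (H : hilbertType R).

(** [C] and [D] form a homotopy of the Koszul complex between [F] and 0; since [F] commutes with [A]
    and [B], its inverse turns this into exactness. *)
Lemma koszul_exact_ideal (A B C D F : H -> H) :
  linear A -> linear B -> linear C -> linear D ->
  commuting_ops A C -> commuting_ops A D -> commuting_ops B C ->
  commuting_ops B D -> commuting_ops A B ->
  bijective F -> (forall x, F x = C (A x) + D (B x)) -> koszul_exact A B.
Proof.
move=> lA lB lC lD AC AD BC BD AB [G FK GK] FE.
have LA := linE lA; have LB := linE lB.
have FA x : F (A x) = A (F x) by rewrite !FE LA -AB AC AD.
have FB x : F (B x) = B (F x) by rewrite !FE LB AB BC BD.
have iF := can_inj FK.
split=> [z Az Bz|x y AyBx|w].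
- by apply: iF; rewrite !FE Az Bz LA LB.
- exists (G (C x + D y)); split; apply: iF.
    by rewrite FA GK LA AC AD AyBx FE.
  by rewrite FB GK LB BC BD -AyBx FE.
- exists (- D (G w)), (C (G w)).
  by rewrite LB opprK AC BD -FE GK.
Qed.

(** Squared reverse triangle inequality: the cross term is at most [|a| nsq x] by Cauchy-Schwarz. *)
Lemma isometry_sub_scalar (Q : H -> H) (a : R[i]) x :
  (forall x, nsq (Q x) = nsq x) ->
  (1 - Num.sqrt (Re a ^+ 2 + Im a ^+ 2)) ^+ 2 * nsq x <= nsq (Q x - a *: x).
Proof.
move=> iQ; set s := Re a ^+ 2 + Im a ^+ 2.
have s0 : 0 <= s by rewrite addr_ge0 ?sqr_ge0.
rewrite nsqB nsqZ iQ -/s.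
have := Cauchy_Schwarz (Q x) (a *: x); rewrite nsqZ iQ -/s.
have := sqr_ge0 (Im '[Q x, a *: x]).
move: (Re _) (Im _) => b c c0 h.
have r0 := sqrtr_ge0 s; have rr := sqr_sqrtr s0; have n0 := nsq_ge0 x.
have : b <= Num.sqrt s * nsq x.
  apply: le_trans (ler_norm _) _; rewrite -(@ler_pXn2r _ 2) ?nnegrE ?mulr_ge0 //.
  by rewrite real_normK ?num_real // exprMn rr; nra.
by rewrite sqrrB expr1n rr; nra.
Qed.

(** Injectivity comes from the lower bound for [Q - a], surjectivity from [riesz] along its adjoint
    [Q' - conj a], which has the same lower bound. *)
Lemma unitary_sub_scalar_bij (Q Q' : H -> H) (a : R[i]) :
  adj Q Q' -> cancel Q Q' -> cancel Q' Q -> `|a| <> 1 ->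
  bijective (fun x => Q x - a *: x).
Proof.
move=> aQ QK QK' a1.
have iQ x : nsq (Q x) = nsq x by rewrite /nsq aQ QK.
have iQ' x : nsq (Q' x) = nsq x by rewrite /nsq (adj_sym aQ) QK'.
pose c := (1 - Num.sqrt (Re a ^+ 2 + Im a ^+ 2)) ^+ 2.
have c0 : 0 < c.
  rewrite lt0r sqr_ge0 andbT sqrf_eq0 subr_eq0; apply/eqP => h; apply: a1.
  by rewrite normc_def -h.
have lQ := linE (adj_linear aQ); have lQ' := linE (adj_linear (adj_sym aQ)).
have aA : adj (fun x => Q x - a *: x) (fun x => Q' x - a^*%C *: x).
  by move=> x y; rewrite !ipE aQ conjcK.
have ca : (1 - Num.sqrt (Re (a^*%C) ^+ 2 + Im (a^*%C) ^+ 2)) ^+ 2 = c.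
  by rewrite /c; case: (a) => p q /=; rewrite sqrrN.
have /choice[G GP] y : exists z, Q z - a *: z = y.
  have [||x|z [hz _ _]] := @riesz R H H 0 (fun x => Q' x - a^*%C *: x)
    (fun x => '[x, y]) (c^-1 * nsq y).
  - by rewrite mulr_ge0 ?nsq_ge0 // invr_ge0 ltW.
  - move=> b x x'; exists (b *: x + x'); split; last by rewrite ipDl ipZl.
    by apply: ip_inj => w; rewrite !(lQ', ipE); ring.
  - apply: le_trans (Cauchy_Schwarz _ _) _.
    rewrite mulrAC ler_wpM2r ?nsq_ge0 // ler_pdivlMl // -ca.
    exact: isometry_sub_scalar.
  - by exists z; apply: ip_inj2 => x; rewrite -(adj_sym aA) -hz.
exists G => // x; apply/eqP; rewrite -subr_eq0; apply/eqP/nsq0_eq0/eqP.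
rewrite eq_le nsq_ge0 andbT -(ler_pM2l c0) mulr0.
apply: le_trans (isometry_sub_scalar _ _ iQ) _.
have := GP (Q x - a *: x); set v := G _ => hv.
have -> : Q (v - x) - a *: (v - x) = 0.
  rewrite !lQ scalerBr; transitivity ((Q v - a *: v) - (Q x - a *: x)).
    by apply: ip_inj => w; rewrite !ipE; ring.
  by rewrite hv subrr.
by rewrite nsq0.
Qed.

Variables (U1 U2 : H -> H).
Hypotheses (lU1 : linear U1) (lU2 : linear U2) (U12 : commuting_ops U1 U2).

(* Everything built from U1 and U2 by linear combinations, composition and
   inversion is in the bicommutant, hence any two such operators commute. *)
Definition bicomm (T : H -> H) : Prop := linear T /\
  forall Y, linear Y -> commuting_ops Y U1 -> commuting_ops Y U2 -> commuting_ops T Y.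

Lemma bicomm1 : bicomm U1.
Proof. by split=> // Y _ h1 _ x; rewrite h1. Qed.

Lemma bicomm2 : bicomm U2.
Proof. by split=> // Y _ _ h2 x; rewrite h2. Qed.

Lemma bicomm_id : bicomm id.
Proof. by split. Qed.

Lemma bicomm_commuting T T' : bicomm T -> bicomm T' -> commuting_ops T T'.
Proof. by move=> [lT cT] [lT' cT']; apply: cT => //; apply: cT'. Qed.

Lemma bicomm_comp T T' : bicomm T -> bicomm T' -> bicomm (T \o T').
Proof.
move=> [lT cT] [lT' cT']; split=> [a x y|Y lY h1 h2 x]; first by rewrite /= lT' lT.
by rewrite /= cT' // cT.
Qed.

Lemma bicomm_iter T n : bicomm T -> bicomm (iter n T).
Proof.
move=> bT; elim: n => [|n IH]; first exact: bicomm_id.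
exact: (bicomm_comp bT IH).
Qed.

Lemma bicommD T T' : bicomm T -> bicomm T' -> bicomm (fun x => T x + T' x).
Proof.
move=> [lT cT] [lT' cT']; split=> [a x y|Y lY h1 h2 x].
  by rewrite lT lT' scalerDr addrACA.
by rewrite (linE lY) cT // cT'.
Qed.

Lemma bicommZ a T : bicomm T -> bicomm (fun x => a *: T x).
Proof.
move=> [lT cT]; split=> [b x y|Y lY h1 h2 x].
  by rewrite lT scalerDr !scalerA mulrC.
by rewrite (linE lY) cT.
Qed.

Lemma bicommB T T' : bicomm T -> bicomm T' -> bicomm (fun x => T x - T' x).
Proof.
move=> bT bT'; have := bicommD bT (bicommZ (-1) bT').
by congr bicomm; apply/funext => x; rewrite scaleN1r.
Qed.

Lemma bicomm_inv T T' : cancel T T' -> cancel T' T -> bicomm T -> bicomm T'.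
Proof.
move=> TK TK' [lT cT]; split=> [a x y|Y lY h1 h2 x]; apply: (can_inj TK).
  by rewrite lT !TK'.
by rewrite TK' (cT Y) // TK'.
Qed.

End Koszul.

Lemma theta_roots (R : realType) (m p : nat) (l : R[i] * R[i]) :
  (0 < m)%N -> (0 < p)%N -> (p %| m)%N ->
  exists a b : R[i], [/\ a + b = l.1, a * b = l.2 ^+ p &
    `|a| = 1 -> `|b| = 1 -> bTheta m p l].
Proof.
move=> m0 p0 pm; case: l => l1 l2 /=.
pose d := sqrtC (l1 ^+ 2 - 4 * l2 ^+ p).
have dd : d ^+ 2 = l1 ^+ 2 - 4 * l2 ^+ p by exact: sqrtCK.
exists ((l1 + d) / 2), ((l1 - d) / 2); split.
- by field.
- transitivity ((l1 ^+ 2 - d ^+ 2) / 4); first by field.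
  by rewrite dd; field.
have : (l1 + d) / 2 + (l1 - d) / 2 = l1 by field.
have : (l1 + d) / 2 * ((l1 - d) / 2) = l2 ^+ p.
  transitivity ((l1 ^+ 2 - d ^+ 2) / 4); first by field.
  by rewrite dd; field.
move: (_ / 2) (_ / 2) => b a ab sab a1 b1.
have k0 : (0 < m %/ p)%N by rewrite divn_gt0 // dvdn_leq.
have mE : m = (m %/ p * p)%N by rewrite divnK.
have rootE (n : nat) (x : R[i]) : (0 < n)%N -> `|x| = 1 ->
    exists z, z ^+ n = x /\ `|z| = 1.
  move=> n0 x1; exists (n.-root x); split; first exact: rootCK.
  by apply/eqP; rewrite -(@pexpr_eq1 _ _ n) // -normrX rootCK // x1.
have [x [xm x1]] := rootE m a m0 a1; have [y [ym y1]] := rootE m b m0 b1.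
(* [c] is the wanted second coordinate up to the p-th root of unity [l2 / c]. Multiplying [x] by [z]
   with [z^(m/p) = l2 / c] repairs it, and [z^m = 1] leaves the first coordinate alone. *)
pose c := (x * y) ^+ (m %/ p).
have c1 : `|c| = 1 by rewrite normrX normrM x1 y1 mulr1 expr1n.
have cn0 : c != 0 by rewrite -normr_gt0 c1.
have cp : c ^+ p = l2 ^+ p by rewrite -exprM -mE exprMn xm ym ab.
have wp : (l2 / c) ^+ p = 1 by rewrite expr_div_n cp divff // -cp expf_neq0.
have w1 : `|l2 / c| = 1.
  by apply/eqP; rewrite -(@pexpr_eq1 _ _ p) // -normrX wp normr1.
have [z [zk z1]] := rootE _ _ k0 w1.
exists (z * x, y); rewrite /= ?normrM ?z1 ?x1 ?y1 ?mulr1 //.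
rewrite /theta /= -mulrA [(z * _) ^+ (_ %/ _)]exprMn zk -/c divfK //.
by rewrite exprMn xm ym {1}mE exprM zk wp mul1r sab.
Qed.

Section UnitaryPair.
Variables (R : realType) (H : hilbertType R) (U1 U1' U2 U2' : H -> H).
Hypotheses (a1 : adj U1 U1') (a2 : adj U2 U2').
Hypotheses (U1K : cancel U1 U1') (U1K' : cancel U1' U1).
Hypotheses (U2K : cancel U2 U2') (U2K' : cancel U2' U2).
Hypothesis U12 : commuting_ops U1 U2.
Variables (m p : nat).
Hypotheses (m0 : (0 < m)%N) (p0 : (0 < p)%N) (pm : (p %| m)%N).

Let Q1 := iter m U1.
Let Q2 := iter m U2.
Let N1 x := Q1 x + Q2 x.
Let N2 := iter (m %/ p) (U1 \o U2).

Let lU1 : linear U1. Proof. exact: adj_linear a1. Qed.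
Let lU2 : linear U2. Proof. exact: adj_linear a2. Qed.

Local Notation bicomm := (bicomm U1 U2).

Let bU1 : bicomm U1. Proof. exact: bicomm1. Qed.
Let bU2 : bicomm U2. Proof. exact: bicomm2. Qed.
Let bU1' : bicomm U1'. Proof. exact: bicomm_inv U1K U1K' bU1. Qed.
Let bU2' : bicomm U2'. Proof. exact: bicomm_inv U2K U2K' bU2. Qed.
Let bQ1 : bicomm Q1. Proof. exact: bicomm_iter. Qed.
Let bQ2 : bicomm Q2. Proof. exact: bicomm_iter. Qed.
Let bN1 : bicomm N1. Proof. exact: bicommD. Qed.
Let bN2 : bicomm N2. Proof. by apply: bicomm_iter; apply: bicomm_comp. Qed.

Let comm (T T' : H -> H) : bicomm T -> bicomm T' -> commuting_ops T T'.
Proof. exact: bicomm_commuting. Qed.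

Let iter_can (T T' : H -> H) n : cancel T T' -> cancel (iter n T) (iter n T').
Proof. by move=> TK; elim: n => // n IH x; rewrite iterSr /= TK IH. Qed.

Lemma iter_comp n x : iter n (U1 \o U2) x = iter n U1 (iter n U2 x).
Proof.
elim: n => //= n ->; congr U1; apply: comm => //; exact: bicomm_iter.
Qed.

Let N2p x : iter p N2 x = Q1 (Q2 x).
Proof. by rewrite /N2 -iterM mulnC divnK // iter_comp. Qed.

(** The cofactor of [N2 - l] in [N2^n - l^n]. *)
Fixpoint geometric (l : R[i]) n (x : H) : H :=
  if n is n.+1 then N2 (geometric l n x) + l ^+ n *: x else 0.

Let bicomm_geometric l n : bicomm (geometric l n).
Proof.
elim: n => [|n IH].
  split=> [a x y|Y lY _ _ x] /=; first by rewrite scaler0 addr0.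
  by rewrite (linE lY).
exact: bicommD (bicomm_comp bN2 IH) (bicommZ _ (bicomm_id _ _)).
Qed.

Let geometricE l n x :
  geometric l n (N2 x - l *: x) = iter n N2 x - l ^+ n *: x.
Proof.
have lN := linE bN2.1.
elim: n => [|n IH] /=; first by rewrite scale1r subrr.
rewrite IH !lN; move: (iter n N2 x) => y.
by apply: ip_inj => z; rewrite !ipE exprSr; ring.
Qed.

(* With Q_i = U_i^m we have N2^p = Q1 Q2, so both (Q_i - a) (Q_i - b) lie in the
   ideal generated by N1 - l.1 and N2 - l.2. Hence so does (Q1 - a)^2 if a = b,
   and (b - a) (Q1 - a) (Q2 - a) otherwise; Q_i - a is invertible. *)
Lemma koszul_exact_theta (l : R[i] * R[i]) a b :
  a + b = l.1 -> a * b = l.2 ^+ p -> `|a| <> 1 ->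
  koszul_exact (fun x => N1 x - l.1 *: x) (fun x => N2 x - l.2 *: x).
Proof.
move=> sab ab na1.
have bA : bicomm (fun x => N1 x - l.1 *: x).
  exact: bicommB bN1 (bicommZ _ (bicomm_id _ _)).
have bB : bicomm (fun x => N2 x - l.2 *: x).
  exact: bicommB bN2 (bicommZ _ (bicomm_id _ _)).
pose S := geometric l.2 p.
have bS : bicomm S by exact: bicomm_geometric.
have SB x : S (N2 x - l.2 *: x) = Q1 (Q2 x) - (a * b) *: x.
  by rewrite /S geometricE N2p ab.
have kos (C D F : H -> H) : bicomm C -> bicomm D -> bijective F ->
    (forall x, F x = C (N1 x - l.1 *: x) + D (N2 x - l.2 *: x)) ->
    koszul_exact (fun x => N1 x - l.1 *: x) (fun x => N2 x - l.2 *: x).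
  move=> bC bD bF FE.
  exact: (koszul_exact_ideal bA.1 bB.1 bC.1 bD.1
    (comm bA bC) (comm bA bD) (comm bB bC) (comm bB bD) (comm bA bB) bF FE).
have lQ1 := linE bQ1.1; have lQ2 := linE bQ2.1.
have Q21 x : Q2 (Q1 x) = Q1 (Q2 x) by exact: comm.
have bX (Q : H -> H) : bicomm Q -> bicomm (fun x => Q x - a *: x).
  by move=> bQ; exact: bicommB bQ (bicommZ _ (bicomm_id _ _)).
pose X1 x := Q1 x - a *: x; pose X2 x := Q2 x - a *: x.
have bX1 : bicomm X1 by exact: bX.
have bX2 : bicomm X2 by exact: bX.
have X1bij : bijective X1.
  apply: unitary_sub_scalar_bij (adj_iter m a1) _ _ na1; exact: iter_can.
have X2bij : bijective X2.
  apply: unitary_sub_scalar_bij (adj_iter m a2) _ _ na1; exact: iter_can.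
have [eab|nab] := eqVneq a b.
  (* [(Q1 - a)^2 = Q1 (Q1 + Q2 - 2 a) - (Q1 Q2 - a^2)]. *)
  apply: (kos Q1 (fun x => (-1) *: S x) (X1 \o X1)) => //.
  - exact: bicommZ.
  - exact: bij_comp.
  - move=> x; rewrite SB -sab -eab /= /X1 /N1; apply: ip_inj => y.
    by rewrite !(lQ1, lQ2, Q21, ipE); ring.
(* With [A = N1 - l.1] and [E = Q1 Q2 - a b], [(Qi - a) (Qi - b) = Qi A - E]. Multiply the case i =
   1 by [X2], the case i = 2 by [X1], and add: as [Q1 + Q2 - 2 b = A + a - b], the left side becomes
   [X1 X2 (A + a - b)]. *)
apply: (kos (fun x => X1 (X2 x) - (X2 (Q1 x) + X1 (Q2 x)))
  (fun x => X1 (S x) + X2 (S x)) (fun x => (b - a) *: X1 (X2 x))).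
- apply: bicommB; first exact: bicomm_comp bX1 bX2.
  by apply: bicommD; [exact: bicomm_comp bX2 bQ1|exact: bicomm_comp bX1 bQ2].
- by apply: bicommD; apply: bicomm_comp.
- have ba0 : b - a != 0 by rewrite subr_eq0 eq_sym.
  apply: (@bij_comp _ _ _ (fun x => (b - a) *: x) (X1 \o X2)); last exact: bij_comp.
  exists (fun x => (b - a)^-1 *: x) => x; first by rewrite scalerA mulVf // scale1r.
  by rewrite scalerA divff // scale1r.
- move=> x; rewrite SB -sab /X1 /X2 /N1; apply: ip_inj => y.
  by rewrite !(lQ1, lQ2, Q21, ipE); ring.
Qed.

Lemma theta_unitary_of_unitaries : theta_unitary m p N1 N2.
Proof.
have norm_iter (V V' : H -> H) n x : adj V V' -> cancel V V' -> `|iter n V x| = `|x|.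
  move=> aV VK; elim: n => //= n <-.
  by rewrite !normE /nsq aV VK.
have aN1 := adjD (adj_iter m a1) (adj_iter m a2).
have aN2 : adj N2 (iter (m %/ p) (U2' \o U1')) by apply/adj_iter/adj_comp.
(* [Ui'] is also the inverse of [Ui], so the adjoints of [N1] and [N2] stay in the bicommutant; this
   gives normality. *)
have bN1' : bicomm (fun x => iter m U1' x + iter m U2' x).
  by apply: bicommD; apply: bicomm_iter.
have bN2' : bicomm (iter (m %/ p) (U2' \o U1')).
  by apply: bicomm_iter; apply: bicomm_comp.
split.
- split; last by eexists; [exact: aN1|exact: comm].
  split; first exact: bN1.1.
  exists 2 => x; apply: le_trans (ler_normD _ _) _.
  by rewrite (norm_iter _ _ _ _ a1) // (norm_iter _ _ _ _ a2) // rmorph_nat mulr_natl.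
- split; last by eexists; [exact: aN2|exact: comm].
  split; first exact: bN2.1.
  exists 1 => x; rewrite mul1r (norm_iter _ (U2' \o U1')) //; first exact: adj_comp.
  by move=> y /=; rewrite U1K U2K.
- exact: comm.
move=> l hl; apply: contrapT => nl; apply: hl.
have [a [b [sab ab hab]]] := theta_roots l m0 p0 pm.
have [a_1|na] := pselect (`|a| = 1); last exact: koszul_exact_theta sab ab na.
have nb : `|b| <> 1 by move=> b_1; apply: nl; exact: hab.
have sba : b + a = l.1 by rewrite addrC.
have ba : b * a = l.2 ^+ p by rewrite mulrC.
exact: koszul_exact_theta sba ba nb.
Qed.

End UnitaryPair.

Theorem theorem5p7 (R : realType) (m p : nat)
    (hm : (1 <= m)%N) (hp : (1 <= p)%N) (hpm : (p %| m)%N)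
    (H : hilbertType R) (T1 T2 : H -> H)
    (hT1 : contraction_op T1) (hT2 : contraction_op T2) (hT : commuting_ops T1 T2) :
  exists (K : hilbertType R) (V : H -> K) (W1 W2 : K -> K),
    theta_isometric_dilation m p
      (fun x => iter m T1 x + iter m T2 x) (iter (m %/ p) (T1 \o T2))
      V W1 W2.
Proof.
have [T1' c1] := contraction_cpair hT1; have [T2' c2] := contraction_cpair hT2.
have [K [V [V1 [V1' [V2 [V2' [isoV [a1 a2] [i1 i2] c12 [e1 e2]]]]]]]] :=
  ando c1 c2 hT.
have [L [J [U1 [U1' [U2 [U2' [isoJ [aU1 aU2] [U1K U2K] [U1K' U2K'] [U12 [f1 f2]]]]]]]]] :=
  unitary_extension a1 a2 i1 i2 c12.
(* Used along [J] to restrict the unitary pair, and along [V] for the adjoints. *)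
have inter (X Y : hilbertType R) (f : X -> Y) (A : Y -> Y) (B : X -> X) n :
    (forall x, A (f x) = f (B x)) -> forall x, iter n A (f x) = f (iter n B x).
  by move=> h; elim: n => //= n IH x; rewrite IH h.
have lV := linE isoV.1; have lJ := linE isoJ.1.
exists K, V, (fun x => iter m V1 x + iter m V2 x), (iter (m %/ p) (V1 \o V2)).
split => //.
- exists L, (fun x => iter m U1 x + iter m U2 x), (iter (m %/ p) (U1 \o U2)), J.
  split => // [|x|x].
  + exact: (theta_unitary_of_unitaries aU1 aU2 U1K U1K' U2K U2K' U12 hm hp hpm).
  + by rewrite (inter _ _ J U1 V1) // (inter _ _ J U2 V2) // lJ.
  + by rewrite (inter _ _ J _ (V1 \o V2)) // => y /=; rewrite f2 f1.
- exists (fun x => iter m V1' x + iter m V2' x), (fun x => iter m T1' x + iter m T2' x).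
  split; [exact: adjD (adj_iter m a1) (adj_iter m a2)| |].
    exact: adjD (adj_iter m c1.1) (adj_iter m c2.1).
  by move=> h; rewrite (inter _ _ V V1' T1') // (inter _ _ V V2' T2') // lV.
- exists (iter (m %/ p) (V2' \o V1')), (iter (m %/ p) (T2' \o T1')).
  split; [exact: adj_iter (adj_comp a2 a1)|exact: adj_iter (adj_comp c2.1 c1.1)|].
  by move=> h; rewrite (inter _ _ V _ (T2' \o T1')) // => x /=; rewrite e1 e2.
Qed.
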